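(* Let $\Lambda:\,]0,2]\to\,]0,+\infty[$ be a nonincreasing function with $\Lambda(0^+)=+\infty$. If $$\int_0^2\Lambda(t)\,dt=\infty,$$ then every singular inner function $U$ is cyclic in $\mathcal{B}^2_{\Lambda,\mathbb{T}}$.
   Context: $\mathbb{D}$ is the open unit disk in $\mathbb{C}$, $\mathbb{T}$ is the unit circle, and $\mu$ is normalized Lebesgue (area) measure on $\mathbb{D}$. $\mathcal{B}^2_{\Lambda,\mathbb{T}}$ is the space of all analytic functions $f$ on $\mathbb{D}$ such that $$\|f\|_{\Lambda,\mathbb{T},2}^2=\int_{\mathbb{D}}|f(z)|^2e^{-2\Lambda(1-|z|)}\,d\mu(z)<\infty.$$ A function $f\in\mathcal{B}^2_{\Lambda,\mathbb{T}}$ is cyclic in $\mathcal{B}^2_{\Lambda,\mathbb{T}}$ if $\{pf: p\text{ a polynomial}\}$ is dense in $\mathcal{B}^2_{\Lambda,\mathbb{T}}$. A singular inner function is a function of the form $U(z)=\exp\left(-\int_{\mathbb{T}}\frac{\zeta+z}{\zeta-z}\,d\nu(\zeta)\right)$, where $\nu$ is a finite positive Borel measure on $\mathbb{T}$ that is singular with respect to Lebesgue measure. *)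

(* Defs.v *)
From HB Require Import structures.
From mathcomp Require Import all_boot all_order all_algebra.
From mathcomp Require Import all_classical all_reals all_analysis.
From mathcomp Require Export complex.

Set Implicit Arguments.
Unset Strict Implicit.
Unset Printing Implicit Defensive.

Import Order.TTheory GRing.Theory Num.Theory.
Import numFieldNormedType.Exports.

Local Open Scope classical_set_scope.
Local Open Scope ring_scope.
Local Open Scope complex_scope.

Section Plane.
Variable R : realType.

(* [`|z|] lives in [R[i]]; this is the same modulus, as an element of [R]. *)
Definition cabs (z : R[i]) : R := complex.Re `|z|.

Definition cexp (z : R[i]) : R[i] :=
  (expR (complex.Re z))%:C * (cos (complex.Im z) +i* sin (complex.Im z)).

(* Measures on the complex plane are carried by [R * R], whose product
   sigma-algebra is the Borel one. *)
Local Notation plane := (measurableTypeR R * measurableTypeR R)%type.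
Definition toC (w : plane) : R[i] := w.1 +i* w.2.

Definition disk : set R[i] := [set z | cabs z < 1].
Definition circle : set R[i] := [set z | cabs z = 1].

(* Only the values of [f] near points of the disk matter, as the radius [r] may
   be shrunk so that the ball lies inside the disk. *)
Definition analytic_on_disk (f : R[i] -> R[i]) : Prop :=
  forall a, disk a -> exists2 r : R, 0 < r & exists c : nat -> R[i],
    forall z, cabs (z - a) < r ->
      series (fun n => c n * (z - a) ^+ n : R[i]^o) @ \oo --> (f z : R[i]^o).

Definition cintegral (nu : {measure set plane -> \bar R}) (A : set R[i])
    (g : R[i] -> R[i]) : R[i] :=
  Rintegral nu (toC @^-1` A) (fun w => complex.Re (g (toC w))) +i*
  Rintegral nu (toC @^-1` A) (fun w => complex.Im (g (toC w))).

(* Lebesgue measure of the unit circle (arc length divided by 2 pi), extended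
   by zero to the plane. *)
Definition circle_lebesgue (A : set plane) : \bar R :=
  ((2 * pi)^-1%:E *
   lebesgue_measure [set t : R | (0 <= t < 2 * pi)%R /\ A (cos t, sin t)])%E.

Definition mutually_singular (m1 m2 : set plane -> \bar R) : Prop :=
  exists N : set plane, [/\ measurable N, m1 N = 0%E & m2 (~` N) = 0%E].

(* A Borel measure on the circle is the same thing as a Borel measure on the
   plane for which the complement of the circle is null. *)
Definition singular_inner (U : R[i] -> R[i]) : Prop :=
  exists nu : {finite_measure set plane -> \bar R},
    [/\ nu (~` (toC @^-1` circle)) = 0%E,
        mutually_singular nu circle_lebesgue &
        forall z, disk z ->
          U z = cexp (- cintegral nu circle (fun zeta => (zeta + z) / (zeta - z)))].

Lemma invpi_ge0 : 0 <= (pi^-1 : R).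
Proof. by rewrite invr_ge0 pi_ge0. Qed.

(* Normalized so that the disk has area 1. *)
Definition area : {measure set plane -> \bar R} :=
  mscale (NngNum invpi_ge0)
    (@lebesgue_measure R \x @lebesgue_measure R)%E.

Section Bergman.
Variable Lambda : R -> R.

Definition B2norm (f : R[i] -> R[i]) : \bar R :=
  sqrte (\int[area]_(w in toC @^-1` disk)
    (cabs (f (toC w)) ^+ 2 * expR (- (2 * Lambda (1 - cabs (toC w)))))%R%:E)%E.

(* Elements of the space are represented by total functions on [R[i]]; values
   outside the disk are irrelevant. *)
Definition B2 : set (R[i] -> R[i]) :=
  [set f | analytic_on_disk f /\ (B2norm f < +oo)%E].

Definition B2dense (S : set (R[i] -> R[i])) : Prop :=
  forall g, B2 g -> forall e : R, 0 < e ->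
    exists2 h, S h & (B2norm (h \- g)%R < e%:E)%E.

Definition B2cyclic (f : R[i] -> R[i]) : Prop :=
  B2 f /\ B2dense [set (fun z => p.[z] * f z) | p in [set: {poly R[i]}]].

End Bergman.
End Plane.

(* Main.v *)
Require Import Defs.
From HB Require Import structures.
From mathcomp Require Import all_boot all_order all_algebra all_solvable all_field.
From mathcomp Require Import all_classical all_reals all_analysis.
From mathcomp Require Import measurable_realfun.
From mathcomp Require Import ring lra.

Set Implicit Arguments.
Unset Strict Implicit.
Unset Printing Implicit Defensive.
Import Order.TTheory GRing.Theory Num.Theory.
Import numFieldNormedType.Exports.
Local Open Scope classical_set_scope.
Local Open Scope ring_scope.
Local Open Scope complex_scope.

(** The function $U$ is bounded, and its reciprocal grows at the boundary like the
    exponential of a Poisson integral. Cyclicity follows once bounded functions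
    $F$, uniformly approximable by polynomials on the disk, are found with
    $F U \to 1$ pointwise and $|F U| \le e^{\Lambda(1-|z|)}$: dominated convergence
    then gives $F U \to 1$ in norm ([approx_one]), so $1$ lies in the closed span of
    the $pU$, and multiplying by polynomials, which are dense ([poly_dense]),
    finishes the proof ([inner_cyclic]).

    To build $F$, write the kernel as
    $\frac{\zeta+z}{\zeta-z} = \frac{2}{x} - 1$ with $x = 1 - z/\zeta$, so that
    $\Re x \ge t := 1-|z|$. For a shift $d > 0$ the kernel $\frac1{d+x}$ is bounded,
    and $\Re\frac1{d+x} - \frac{d}{|d+x|^2} \le \Re\frac1x$. Sacrificing a
    factor $1-e$ turns this into
    $$\Re\Bigl(\frac{1-e}{d+x} - \frac1x\Bigr) \le \frac1d\,1_{t < d/e}$$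
    ([Re_inv_shift_le]): the excess is confined to the points with $t < d/e$ and has
    height $1/d$. Averaging over the shifts $d_j = e2^{-j-1}$ with weights
    $c_j = 2^{-j-1}(\Lambda(2^{-j-1})-\Lambda(2^{-j}))/W$, where $W$ makes
    $\sum c_j = 1$, the excess telescopes to at most $\Lambda(t)/(eW)$
    ([sum_jump_le]). The condition $\int\Lambda = \infty$ says, after condensation
    and summation by parts, that $W$ can be taken arbitrarily large
    ([jump_sum_unbounded]). Hence the total excess is below $\Lambda(t)$ however large
    the mass of $\nu$ is, while the averaged kernel still tends to the original one as
    $e \to 0$ because all the shifts are at most $e$ ([almost_inverse]).

    Density of the polynomials rests on two facts. A function with local power series
    throughout the disk has a single Taylor series there ([global_taylor]); this is
    proved by extending the disk of convergence through re-expansion and Cauchy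
    estimates, where averages over regular polygons take the place of contour
    integrals. And the weighted area is rotation invariant ([mass_rotation]), which
    makes the monomials orthogonal; Bessel's inequality ([bessel]) then shows that
    Taylor polynomials converge in norm. The notion that is manipulated throughout is
    that of a uniform limit of polynomials ([polylim]): locally it is equivalent to
    having a power series, and it passes easily through exponentials and
    integrals. *)

(** * Modulus and convergence of complex numbers *)

Section Modulus.
Variable R : realType.
Local Notation C := R[i].
Implicit Types (z w : C) (x : R).

Lemma cabsE z : `|z| = (cabs z)%:C.
Proof. by rewrite /cabs normc_def. Qed.

Lemma cabs_sqr z : cabs z ^+ 2 = complex.Re z ^+ 2 + complex.Im z ^+ 2.
Proof. by rewrite /cabs normc_def /= sqr_sqrtr // addr_ge0 ?sqr_ge0. Qed.

Lemma cabs_ge0 z : 0 <= cabs z.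
Proof. by rewrite /cabs normc_def /= sqrtr_ge0. Qed.

Lemma cabs0 : cabs (0 : C) = 0.
Proof. by rewrite /cabs normr0. Qed.

Lemma cabs1 : cabs (1 : C) = 1.
Proof. by rewrite /cabs normr1. Qed.

Lemma cabs_eq0 z : cabs z = 0 -> z = 0.
Proof. by move=> h; apply/eqP; rewrite -normr_eq0 cabsE h. Qed.

Lemma cabsM z w : cabs (z * w) = cabs z * cabs w.
Proof. by apply: (@complexI R); rewrite rmorphM /= -!cabsE normrM. Qed.

Lemma cabsX z n : cabs (z ^+ n) = cabs z ^+ n.
Proof. by elim: n => [|n IH]; rewrite ?expr0 ?cabs1 // !exprS cabsM IH. Qed.

Lemma cabsN z : cabs (- z) = cabs z.
Proof. by rewrite /cabs normrN. Qed.

Lemma cabs_distC z w : cabs (z - w) = cabs (w - z).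
Proof. by rewrite -opprB cabsN. Qed.

Lemma cabs_le_add z w : cabs (z + w) <= cabs z + cabs w.
Proof. by rewrite -lecR rmorphD /= -!cabsE ler_normD. Qed.

Lemma cabs_le_sub z w : cabs (z - w) <= cabs z + cabs w.
Proof. by rewrite (le_trans (cabs_le_add _ _)) // cabsN. Qed.

Lemma cabs_triangle w z u : cabs (z - u) <= cabs (z - w) + cabs (w - u).
Proof. by rewrite (le_trans _ (cabs_le_add _ _)) // addrA subrK. Qed.

Lemma cabs_real x : cabs (x%:C) = `|x|.
Proof. by rewrite /cabs normc_def /= expr0n addr0 sqrtr_sqr. Qed.

Lemma cabsMn z n : cabs (z *+ n) = cabs z *+ n.
Proof.
by rewrite -mulr_natl cabsM -(rmorph_nat (@real_complex R)) cabs_real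
  ger0_norm ?mulr_natl.
Qed.

Lemma cabsV z : cabs z^-1 = (cabs z)^-1.
Proof. by apply: (@complexI R); rewrite fmorphV /= -!cabsE normfV. Qed.

Lemma cabs_sum I (r : seq I) (P : pred I) (F : I -> C) :
  cabs (\sum_(i <- r | P i) F i) <= \sum_(i <- r | P i) cabs (F i).
Proof.
elim/big_ind2 : _ => //=; first by rewrite cabs0.
by move=> a b c d h1 h2; rewrite (le_trans (cabs_le_add _ _)) // lerD.
Qed.

Lemma Re_le_cabs z : `|complex.Re z| <= cabs z.
Proof.
by rewrite -(ler_pXn2r (n := 2)) ?nnegrE ?cabs_ge0 // cabs_sqr real_normK
  ?num_real // lerDl sqr_ge0.
Qed.

Lemma Im_le_cabs z : `|complex.Im z| <= cabs z.
Proof.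
by rewrite -(ler_pXn2r (n := 2)) ?nnegrE ?cabs_ge0 // cabs_sqr real_normK
  ?num_real // lerDr sqr_ge0.
Qed.

Lemma cabs_le_Re_Im z : cabs z <= `|complex.Re z| + `|complex.Im z|.
Proof.
case: z => a b /=; have -> : a +i* b = a%:C + b%:C * 'i.
  by apply/eqP; rewrite eq_complex /=; apply/andP; split; apply/eqP; ring.
rewrite (le_trans (cabs_le_add _ _)) // cabsM !cabs_real.
suff -> : cabs ('i : C) = 1 by rewrite mulr1.
by rewrite /cabs normc_def /= expr0n expr1n add0r sqrtr1.
Qed.

Lemma cabs_sqr_conj z : (cabs z ^+ 2)%:C = z * Num.conj z.
Proof. by rewrite rmorphXn /= -cabsE normCK. Qed.

Lemma ReD z w : complex.Re (z + w) = complex.Re z + complex.Re w.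
Proof. by case: z; case: w. Qed.
Lemma ImD z w : complex.Im (z + w) = complex.Im z + complex.Im w.
Proof. by case: z; case: w. Qed.
Lemma ReN z : complex.Re (- z) = - complex.Re z. Proof. by case: z. Qed.
Lemma ImN z : complex.Im (- z) = - complex.Im z. Proof. by case: z. Qed.

(** Completeness of the complex numbers, obtained from the real and imaginary
    parts. The rate of convergence survives up to a factor $2$, which later gives
    estimates that are uniform in a parameter. *)
Lemma ccomplete (u : nat -> C) (b : nat -> R) :
  b n @[n --> \oo] --> 0 ->
  (forall k l, (k <= l)%N -> cabs (u k - u l) <= b k) ->
  exists c, forall k, cabs (u k - c) <= b k *+ 2.
Proof.
move=> b0 ub.
have re (g : C -> R) (gle : forall z, `|g z| <= cabs z)
    (gB : forall z w, g (z - w) = g z - g w) :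
  exists l : R, forall k, `|g (u k) - l| <= b k.
  have gk k l : (k <= l)%N -> `|g (u k) - g (u l)| <= b k.
    by move=> kl; rewrite -gB (le_trans (gle _)) // ub.
  have : cauchy ((g \o u) @ \oo).
    apply/cauchyP => e e0.
    move/cvgrPdist_lt : b0 => /(_ e e0) [N _ hN].
    exists (g (u N)); exists N => // n /= Nn.
    rewrite /ball /= (le_lt_trans (gk _ _ Nn)) //.
    have := hN N (leqnn N); rewrite /= sub0r normrN; exact/le_lt_trans/ler_norm.
  move/cauchy_cvgP/cvg_ex => [l /= hl]; exists l => k.
  have cv : `|g (u k) - g (u n)| @[n --> \oo] --> `|g (u k) - l|.
    by apply: cvg_norm; apply: cvgB; [exact: cvg_cst|exact: hl].
  have /cvg_lim <- // := cv.
  by apply: limr_le; [apply/cvg_ex; eexists; exact: cv|exists k => // n /= kn; apply: gk].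
have [a ha] := re (@complex.Re R) Re_le_cabs
  (fun z w => etrans (ReD z (- w)) (congr1 _ (ReN w))).
have [c hc] := re (@complex.Im R) Im_le_cabs
  (fun z w => etrans (ImD z (- w)) (congr1 _ (ImN w))).
exists (a +i* c) => k; rewrite (le_trans (cabs_le_Re_Im _)) // mulr2n lerD //.
  by rewrite ReD ReN; exact: ha.
by rewrite ImD ImN; exact: hc.
Qed.

Lemma ccvgP (u : nat -> C) (l : C) :
  (u @ \oo --> (l : R[i]^o)) <->
  (forall e : R, 0 < e -> exists N, forall n, (N <= n)%N -> cabs (u n - l) < e).
Proof.
split.
  move=> /(@cvgrPdist_lt _ R[i]^o) h e e0.
  have [|N _ hN] := h e%:C; first by rewrite ltcR.
  exists N => n Nn; have := hN n Nn.
  by rewrite -ltcR cabs_distC -cabsE; exact.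
move=> h; apply/(@cvgrPdist_lt _ R[i]^o) => e e0.
have er : (complex.Re e)%:C = e by apply: RRe_real; rewrite ger0_real // ltW.
have [|N hN] := h (complex.Re e); first by rewrite -ltcR er.
exists N => // n /= Nn; rewrite -er cabsE ltcR cabs_distC; exact: hN.
Qed.

End Modulus.

(** * The complex exponential *)

Section ComplexExponential.
Variable R : realType.
Local Notation C := R[i].
Implicit Types (z w : C) (x y : R).

Lemma cexpD z w : cexp (z + w) = cexp z * cexp w.
Proof.
case: z => a b; case: w => c d; rewrite /cexp /= expRD cosD sinD.
by apply/eqP; rewrite eq_complex /=; apply/andP; split; apply/eqP; ring.
Qed.

Lemma cexp0 : cexp (0 : C) = 1.
Proof.
by rewrite /cexp /= expR0 cos0 sin0; apply/eqP; rewrite eq_complex /=; apply/andP;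
  split; apply/eqP; ring.
Qed.

Lemma cabs_cexp z : cabs (cexp z) = expR (complex.Re z).
Proof.
rewrite /cexp cabsM cabs_real ger0_norm ?expR_ge0 //.
suff -> : cabs (cos (complex.Im z) +i* sin (complex.Im z)) = 1 by rewrite mulr1.
by rewrite /cabs normc_def /= cos2Dsin2 sqrtr1.
Qed.

Lemma cexpXn z n : cexp z ^+ n = cexp (z *+ n).
Proof. by elim: n => [|n IH]; rewrite ?cexp0 // exprS IH -cexpD mulrS. Qed.

Lemma abs_sin_le x : `|sin x| <= `|x|.
Proof.
wlog x0 : x / 0 <= x.
  move=> h; case: (leP 0 x) => [/h//|/ltW x0].
  by rewrite -normrN -sinN -[in leRHS]normrN h // oppr_ge0.
have [->|xN0] := eqVneq x 0; first by rewrite sin0.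
have xp : 0 < x by rewrite lt_def xN0.
have [|c _] := @MVT R sin cos 0 x xp (fun c _ => is_derive_sin c).
  by apply: continuous_subspaceT => c; exact: continuous_sin.
rewrite sin0 !subr0 => ->; rewrite normrM ler_piMl //.
exact: cos_max.
Qed.

Lemma abs_cosB1_le x : `|cos x - 1| <= x ^+ 2 / 2.
Proof.
have -> : cos x - 1 = - (sin (x / 2) ^+ 2 *+ 2).
  have {1}-> : x = (x / 2) *+ 2 by rewrite mulr2n -splitr.
  by rewrite cos_mulr2n; have := cos2Dsin2 (x / 2); lra.
rewrite normrN ger0_norm ?mulrn_wge0 ?sqr_ge0 //.
have : sin (x / 2) ^+ 2 <= (x / 2) ^+ 2.
  by rewrite -ler_sqrt ?sqr_ge0 // !sqrtr_sqr abs_sin_le.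
lra.
Qed.

Lemma abs_sinB_le x : `|x| <= 1 -> `|sin x - x| <= x ^+ 2.
Proof.
move=> x1.
wlog x0 : x x1 / 0 <= x.
  move=> h; case: (leP 0 x) => [/h//|/ltW x0]; first exact.
  rewrite -normrN -(sqrrN x) opprD -sinN h ?oppr_ge0 // normrN //.
have [->|xN0] := eqVneq x 0; first by rewrite sin0 subrr normr0 sqr_ge0.
have xp : 0 < x by rewrite lt_def xN0.
have [|c] := @MVT R sin cos 0 x xp (fun c _ => is_derive_sin c).
  by apply: continuous_subspaceT => c; exact: continuous_sin.
rewrite in_itv /= sin0 !subr0 => /andP[c0 cx] ->.
have -> : cos c * x - x = (cos c - 1) * x by ring.
rewrite normrM (ger0_norm x0) expr2 ler_wpM2r //.
have := abs_cosB1_le c; rewrite ger0_norm in x1 => //; nra.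
Qed.

Lemma abs_expRB_le x : `|x| <= 1/2 -> `|expR x - 1 - x| <= x ^+ 2 *+ 2.
Proof.
move=> x1.
have h1 := expR_ge1Dx x.
have h2 := expR_ge1Dx (- x).
have e0 := expR_gt0 x.
have e1 : expR x * expR (- x) = 1 by rewrite -expRD subrr expR0.
move: x1; rewrite ler_norml => /andP[xl xu].
rewrite ger0_norm; last lra.
nra.
Qed.

Lemma cabs_cexpB_le z : cabs z <= 1/2 -> cabs (cexp z - 1 - z) <= cabs z ^+ 2 *+ 10.
Proof.
case: z => x y h.
have hx : `|x| <= 1/2 := le_trans (Re_le_cabs (x +i* y)) h.
have hy : `|y| <= 1/2 := le_trans (Im_le_cabs (x +i* y)) h.
have ex := abs_expRB_le hx.
have cy := abs_cosB1_le y.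
have sy : `|sin y - y| <= y ^+ 2 by apply: abs_sinB_le; lra.
have e2 : expR x <= 2 by move: ex hx; rewrite !ler_norml; nra.
have e0 := expR_gt0 x.
have sq := cabs_sqr (x +i* y); rewrite /= in sq.
have := sqr_ge0 x; have := sqr_ge0 y; move=> y2 x2.
rewrite (le_trans (cabs_le_Re_Im _)) // /cexp /=.
have -> : expR x * cos y - 0 * sin y - 1 - x = (expR x - 1 - x) + expR x * (cos y - 1) by ring.
have -> : expR x * sin y + 0 * cos y - 0 - y =
  expR x * (sin y - y) + (expR x - 1 - x) * y + x * y by ring.
have a1 : `|expR x * (cos y - 1)| <= y ^+ 2.
  rewrite normrM (ger0_norm (ltW e0)); have := normr_ge0 (cos y - 1); nra.
have a2 : `|expR x * (sin y - y)| <= 2 * y ^+ 2.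
  rewrite normrM (ger0_norm (ltW e0)); have := normr_ge0 (sin y - y); nra.
have a3 : `|(expR x - 1 - x) * y| <= x ^+ 2.
  rewrite normrM; have := normr_ge0 y; have := normr_ge0 (expR x - 1 - x); nra.
have a4 : `|x * y| <= x ^+ 2 + y ^+ 2.
  rewrite normrM -(real_normK (num_real x)) -(real_normK (num_real y)).
  by have := sqr_ge0 (`|x| - `|y|); have := normr_ge0 x; have := normr_ge0 y; nra.
have := ler_normD (expR x - 1 - x) (expR x * (cos y - 1)).
have := ler_normD (expR x * (sin y - y) + (expR x - 1 - x) * y) (x * y).
have := ler_normD (expR x * (sin y - y)) ((expR x - 1 - x) * y).
rewrite sq; lra.
Qed.

Lemma cabs_subX_le z w (m : R) n : cabs z <= m -> cabs w <= m ->
  cabs (z ^+ n - w ^+ n) <= cabs (z - w) * (n%:R * m ^+ n.-1).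
Proof.
move=> zm wm; have m0 : 0 <= m := le_trans (cabs_ge0 z) zm.
rewrite subrXX cabsM ler_wpM2l ?cabs_ge0 //.
rewrite (le_trans (cabs_sum _ _ _)) //.
rewrite (_ : n%:R * _ = \sum_(i < n) m ^+ n.-1); last first.
  by rewrite sumr_const card_ord mulr_natl.
apply: ler_sum => i _; rewrite cabsM !cabsX.
have -> : n.-1 = (n.-1 - i + i)%N by rewrite subnK // -ltnS prednK ?(leq_trans _ (ltn_ord i)).
rewrite exprD ler_pM ?exprn_ge0 ?cabs_ge0 // ?lerXn2r ?nnegrE ?cabs_ge0 //.
by rewrite addnK lerXn2r ?nnegrE ?cabs_ge0.
Qed.

(** Compound interest: $(1 + w/n)^n \to e^w$ uniformly for bounded $w$, because
    the factors [cexp (w / n)] and [1 + w / n] agree to second order. *)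
Lemma cexp_poly (M e : R) : 0 <= M -> 0 < e ->
  exists n : nat, forall w, cabs w <= M ->
    cabs ((1 + w / n.+1%:R) ^+ n.+1 - cexp w) <= e.
Proof.
move=> M0 e0.
pose B := 10 * M ^+ 2 * expR M.
have B0 : 0 <= B by rewrite /B !mulr_ge0 ?expR_ge0 ?sqr_ge0.
pose n := Num.truncn (M * 2 + B / e).
have nb : M * 2 + B / e < n.+1%:R by rewrite truncnS_gt.
have Be : 0 <= B / e by rewrite divr_ge0 // ltW.
have n1 : 0 < n.+1%:R :> R by rewrite ltr0n.
exists n => w wM.
set u := w / n.+1%:R.
have cu : cabs u = cabs w / n.+1%:R.
  by rewrite /u cabsM cabsV -(rmorph_nat (@real_complex R)) cabs_real ger0_norm ?ler0n.
have uM : cabs u <= M / n.+1%:R by rewrite cu ler_wpM2r ?invr_ge0 // ltW.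
have u2 : cabs u <= 1/2.
  by rewrite (le_trans uM) // ler_pdivrMr //; lra.
have m1 : cabs (cexp u) <= expR (M / n.+1%:R).
  rewrite cabs_cexp ler_expR (le_trans (ler_norm _)) //.
  by rewrite (le_trans (Re_le_cabs u)).
have m2 : cabs (1 + u) <= expR (M / n.+1%:R).
  rewrite (le_trans (cabs_le_add _ _)) // cabs1 (le_trans _ (expR_ge1Dx _)) //.
  by rewrite lerD2l.
have -> : cexp w = cexp u ^+ n.+1.
  rewrite cexpXn; congr cexp; rewrite -[RHS]mulr_natr /u divfK //.
rewrite (le_trans (cabs_subX_le _ m2 m1)) //.
have h1 : cabs (1 + u - cexp u) <= 10 * (M / n.+1%:R) ^+ 2.
  rewrite cabs_distC opprD addrA (le_trans (cabs_cexpB_le u2)) //.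
  by rewrite -[X in X <= _]mulr_natl ler_wpM2l ?lerXn2r ?nnegrE ?cabs_ge0 ?divr_ge0 // ltW.
have h2 : expR (M / n.+1%:R) ^+ n <= expR M.
  rewrite -expRM_natl ler_expR mulrCA ler_piMr // ler_pdivrMr // mul1r.
  by rewrite ler_nat.
rewrite (@le_trans _ _ (10 * (M / n.+1%:R) ^+ 2 * (n.+1%:R * expR M))) //.
  by rewrite ler_pM ?cabs_ge0 ?mulr_ge0 ?ler0n ?exprn_ge0 ?expR_ge0 // ler_wpM2l.
rewrite (_ : _ * _ = B / n.+1%:R); last first.
  by rewrite /B; move: (lt0r_neq0 n1); move: (n.+1%:R : R) => k k0; field.
rewrite ler_pdivrMr // -ler_pdivrMl // mulrC; lra.
Qed.

End ComplexExponential.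

(** * Polygonal averages and Cauchy estimates *)

Section RootsOfUnity.
Variable R : realType.
Local Notation C := R[i].
Implicit Types (z w : C) (p q : {poly C}).

Lemma prim_root_exists n : (0 < n)%N -> exists w : C, n.-primitive_root w.
Proof.
move=> n0; have [r] := closed_field_poly_normal ('X^n - 1 : {poly C}).
rewrite (monicP (monicXnsubC 1 n0)) scale1r => Er.
have unity : all n.-unity_root r by apply/allP => z; rewrite -root_prod_XsubC -Er.
have ur : uniq r.
  by rewrite -separable_prod_XsubC -Er separable_Xn_sub_1 // pnatr_eq0 -lt0n.
have sr : size r = n.
  by apply: succn_inj; rewrite -(size_prod_XsubC r id) -Er size_XnsubC.
have /hasP[w _ pw] := has_prim_root n0 unity ur (eq_leq (esym sr)).
by exists w.
Qed.

Lemma cabs_prim_root n w : n.-primitive_root w -> cabs w = 1.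
Proof.
move=> pw; apply/eqP; rewrite -(@eqrXn2 _ n) ?cabs_ge0 ?(prim_order_gt0 pw) //.
by rewrite -cabsX prim_expr_order // cabs1 expr1n.
Qed.

Lemma prim_root_neq0 n w : n.-primitive_root w -> w != 0.
Proof.
move=> /cabs_prim_root; apply: contra_eq_neq => ->.
by rewrite cabs0 eq_sym oner_neq0.
Qed.

Lemma conjc_prim_root n w : n.-primitive_root w -> Num.conj w = w^-1.
Proof.
move=> pw; have w0 := prim_root_neq0 pw.
apply: (mulfI w0); rewrite divff // -cabs_sqr_conj.
by rewrite (cabs_prim_root pw) expr1n.
Qed.

(** Orthogonality of the characters of a cyclic group. *)
Lemma sum_prim_root n w (i j : nat) : n.-primitive_root w -> (i < n)%N -> (j < n)%N ->
  \sum_(k < n) (w ^+ k) ^+ i * Num.conj ((w ^+ k) ^+ j) = n%:R * (i == j)%:R.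
Proof.
move=> pw ilt jlt.
have w0 := prim_root_neq0 pw.
have E k : (w ^+ k) ^+ i * Num.conj ((w ^+ k) ^+ j) = (w ^+ i / w ^+ j) ^+ k.
  rewrite !rmorphXn /= (conjc_prim_root pw) !exprVn expr_div_n -!exprM.
  by rewrite [(k * i)%N]mulnC [(k * j)%N]mulnC.
under eq_bigr do rewrite E.
case: eqVneq => [->|ij].
  rewrite (eq_bigr (fun=> 1)) ?sumr_const ?card_ord ?mulr1 // => k _.
  by rewrite divff ?expf_neq0 ?expr1n.
rewrite mulr0; apply: (@mulfI _ (w ^+ i / w ^+ j - 1)).
  rewrite subr_eq0; apply/eqP => /(congr1 (fun x => x * w ^+ j)).
  rewrite divfK ?expf_neq0 // mul1r => /eqP.
  by rewrite (eq_prim_root_expr pw) /= !modn_small // (negbTE ij).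
rewrite -subrX1 mulr0.
have X m : (w ^+ m) ^+ n = 1 by rewrite exprAC (prim_expr_order pw) expr1n.
by rewrite expr_div_n !X divr1 subrr.
Qed.

(** Parseval's identity on a circle, with the average over the circle replaced
    by the average over a regular polygon with enough vertices. *)
Lemma parseval_roots n w p z : n.-primitive_root w -> (size p <= n)%N ->
  \sum_(k < n) cabs p.[w ^+ k * z] ^+ 2 =
  n%:R * \sum_(i < n) (cabs p`_i * cabs z ^+ i) ^+ 2.
Proof.
move=> pw sp; apply: (@complexI R).
rewrite rmorph_sum rmorphM rmorph_nat rmorph_sum /=.
have rearr (a b c d e f : C) : a * (b * c) * (d * (e * f)) = a * c * (d * f) * (b * e).
  by ring.
under eq_bigr => k _.
  rewrite cabs_sqr_conj (horner_coef_wide _ sp) rmorph_sum big_distrlr /=.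
  under eq_bigr => i _.
    under eq_bigr => j _.
      rewrite !exprMn !rmorphM /=.
      rewrite rearr -[Num.conj p`_j * _]rmorphM.
      over.
    over.
  over.
rewrite exchange_big /=.
under eq_bigr => i _.
  rewrite exchange_big /=.
  under eq_bigr => j _ do rewrite -mulr_sumr sum_prim_root //.
  over.
rewrite mulr_sumr; apply: eq_bigr => i _.
rewrite (bigD1 i) //= eqxx mulr1 big1 ?addr0 => [|j ji]; last first.
  by rewrite eq_sym (_ : (j == i :> nat) = false) ?mulr0 //; apply/negbTE.
by rewrite -cabsX -cabsM cabs_sqr_conj mulrC.
Qed.

(** By the discrete Parseval identity, no term of the sum of squares exceeds the
    largest value. *)
Lemma cauchy_coef p (M r : R) n : 0 <= r ->
  (forall z, cabs z = r -> cabs p.[z] <= M) -> cabs p`_n * r ^+ n <= M.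
Proof.
move=> r0 pM.
have cr : cabs (r%:C) = r by rewrite cabs_real ger0_norm.
have M0 : 0 <= M by rewrite (le_trans (cabs_ge0 _) (pM _ cr)).
pose N := maxn (size p) n.+1.
have N0 : (0 < N)%N by rewrite /N leq_max orbT.
have [w pw] := prim_root_exists N0.
have sN : (size p <= N)%N by rewrite leq_maxl.
have := parseval_roots r%:C pw sN; rewrite cr => PE.
have nN : (n < N)%N by rewrite /N leq_max ltnSn orbT.
have c0 : 0 <= cabs p`_n * r ^+ n by rewrite mulr_ge0 ?cabs_ge0 ?exprn_ge0.
rewrite -(@ler_pXn2r _ 2) ?nnegrE //.
rewrite -(@ler_pM2l _ N%:R) ?ltr0n //.
apply: (@le_trans _ _ (\sum_(k < N) cabs p.[w ^+ k * r%:C] ^+ 2)).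
  rewrite PE ler_wpM2l ?ler0n // (bigD1 (Ordinal nN)) //= lerDl.
  by apply: sumr_ge0 => i _; rewrite sqr_ge0.
rewrite (_ : N%:R * _ = \sum_(k < N) M ^+ 2); last first.
  by rewrite sumr_const card_ord mulr_natl.
apply: ler_sum => k _; rewrite lerXn2r ?nnegrE ?cabs_ge0 // pM //.
by rewrite cabsM cabsX (cabs_prim_root pw) expr1n mul1r.
Qed.

(** The numbers $p^{(n)}(b)/n!$ are the coefficients of the polynomial
    $h \mapsto p(b + h)$, so the previous estimate applies around any centre. *)
Lemma cauchy_nderivn p b (M r : R) n : 0 <= r ->
  (forall z, cabs (z - b) <= r -> cabs p.[z] <= M) -> cabs p^`N(n).[b] * r ^+ n <= M.
Proof.
move=> r0 pM.
pose q := \poly_(i < maxn (size p) n.+1) p^`N(i).[b].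
have qE h : q.[h] = p.[b + h].
  rewrite horner_poly (@nderiv_taylor_wide _ (maxn (size p) n.+1)) ?leq_maxl //.
  exact: mulrC.
have -> : p^`N(n).[b] = q`_n by rewrite coef_poly leq_max ltnSn orbT.
apply: cauchy_coef => // z zr; rewrite qE pM //.
by rewrite addrAC subrr add0r zr.
Qed.

End RootsOfUnity.

(** * Uniform limits of polynomials *)

Section PolynomialLimits.
Variable R : realType.
Local Notation C := R[i].
Implicit Types (z w b : C) (p q : {poly C}) (f g : C -> C) (B : set C).

Definition cball b (r : R) : set C := [set z | cabs (z - b) <= r].

Definition polylim B f := forall e : R, 0 < e ->
  exists p, forall z, B z -> cabs (p.[z] - f z) <= e.

Definition psum (c : nat -> C) n : {poly C} := \poly_(k < n) c k.

(** The power series with coefficients [c] around [b] converges to [f]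
    uniformly on the closed ball of radius [r]. *)
Definition useries (c : nat -> C) b r f := forall e : R, 0 < e ->
  exists N, forall n, (N <= n)%N -> forall z, cball b r z ->
    cabs ((psum c n).[z - b] - f z) <= e.

Definition pbound p (r : R) := \sum_(i < size p) cabs p`_i * r ^+ i.

Lemma pboundP p r z : cabs z <= r -> cabs p.[z] <= pbound p r.
Proof.
move=> zr; rewrite horner_coef (le_trans (cabs_sum _ _ _)) //.
apply: ler_sum => i _; rewrite cabsM cabsX ler_wpM2l ?cabs_ge0 //.
by rewrite lerXn2r ?nnegrE ?cabs_ge0 // (le_trans (cabs_ge0 z)).
Qed.

Lemma cball_le b r z : cball b r z -> cabs z <= r + cabs b.
Proof.
move=> h; have := cabs_le_add (z - b) b; rewrite subrK => /le_trans; apply.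
by rewrite lerD2r.
Qed.

Lemma polylim_sub B B' f : B `<=` B' -> polylim B' f -> polylim B f.
Proof. by move=> BB h e /h[p hp]; exists p => z /BB/hp. Qed.

Lemma polylim_ext B f g : (forall z, B z -> f z = g z) -> polylim B f -> polylim B g.
Proof. by move=> fg h e /h[p hp]; exists p => z Bz; rewrite -fg // hp. Qed.

Lemma polylim_poly B p : polylim B (horner p).
Proof. by move=> e e0; exists p => z _; rewrite subrr cabs0 ltW. Qed.

Lemma polylim_lim B f : (forall e : R, 0 < e -> exists2 g, polylim B g &
  forall z, B z -> cabs (g z - f z) <= e) -> polylim B f.
Proof.
move=> h e e0; have e2 : 0 < e / 2 by rewrite divr_gt0.
have [g /(_ _ e2)[p hp] hg] := h _ e2; exists p => z Bz.
by rewrite (le_trans (cabs_triangle (g z) _ _)) // [e]splitr lerD ?hp ?hg.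
Qed.

Lemma polylim_bounded B r f : (forall z, B z -> cabs z <= r) -> polylim B f ->
  exists2 M, 0 < M & forall z, B z -> cabs (f z) <= M.
Proof.
move=> Br /(_ _ ltr01)[p hp]; exists (`|pbound p r| + 1).
  by rewrite ltr_wpDl.
move=> z Bz; have := cabs_le_sub p.[z] (p.[z] - f z); rewrite subKr => /le_trans; apply.
rewrite lerD ?hp // (le_trans _ (ler_norm _)) //; exact/pboundP/Br.
Qed.

Lemma polylimD B f g : polylim B f -> polylim B g -> polylim B (fun z => f z + g z).
Proof.
move=> hf hg e e0; have e2 : 0 < e / 2 by rewrite divr_gt0.
have [p hp] := hf _ e2; have [q hq] := hg _ e2; exists (p + q) => z Bz.
rewrite hornerD opprD addrACA (le_trans (cabs_le_add _ _)) // [e]splitr.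
by rewrite lerD ?hp ?hq.
Qed.

(** Products need both factors bounded, hence a bounded set. *)
Lemma polylimM B r f g : (forall z, B z -> cabs z <= r) ->
  polylim B f -> polylim B g -> polylim B (fun z => f z * g z).
Proof.
move=> Br hf hg e e0.
have [M M0 fM] := polylim_bounded Br hf; have [L L0 gL] := polylim_bounded Br hg.
have d0 : 0 < Num.min 1 (e / (M + L + 1)).
  by rewrite lt_min ltr01 divr_gt0 // !addr_gt0.
have [p hp] := hf _ d0; have [q hq] := hg _ d0; exists (p * q) => z Bz.
move: d0 (hp z Bz) (hq z Bz) (fM z Bz) (gL z Bz).
set d := Num.min _ _ => d0 hp' hq' hM hL.
have d1 : d <= 1 by rewrite /d ge_min lexx.
have de : d * (M + L + 1) <= e.
  by rewrite -ler_pdivlMr ?addr_gt0 // /d ge_min lexx orbT.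
rewrite hornerM (_ : _ - _ = (p.[z] - f z) * (q.[z] - g z) + f z * (q.[z] - g z)
  + (p.[z] - f z) * g z); last by ring.
rewrite (le_trans (cabs_le_add _ _)) // (le_trans _ de) //.
have := cabs_le_add ((p.[z] - f z) * (q.[z] - g z)) (f z * (q.[z] - g z)).
rewrite !cabsM.
have := cabs_ge0 (f z); have := cabs_ge0 (g z).
have := cabs_ge0 (p.[z] - f z); have := cabs_ge0 (q.[z] - g z).
move: (cabs _) hq' => x; move: (cabs _) hp' => y; move: (cabs _) hM => u; move: (cabs _) hL => v.
move=> ? ? ? ? ? ? ? ? h; have : y * x <= d * 1 by apply: ler_pM => //; apply: le_trans d1.
have : u * x <= M * d by apply: ler_pM.
have : y * v <= d * L by apply: ler_pM.
lra.
Qed.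

Lemma polylim_cst B z0 : polylim B (fun=> z0).
Proof. by move=> e e0; exists z0%:P => z _; rewrite hornerC subrr cabs0 ltW. Qed.

Lemma polylim_exp B r f : (forall z, B z -> cabs z <= r) ->
  polylim B f -> polylim B (fun z => cexp (f z)).
Proof.
move=> Br hf; have [M M0 fM] := polylim_bounded Br hf.
apply: polylim_lim => e e0.
have [n hn] := cexp_poly (ltW M0) e0.
exists (fun z => (1 + f z / n.+1%:R) ^+ n.+1); last by move=> z Bz; apply/hn/fM.
move: (n.+1%:R : C) => k; elim: {hn} n.+1 => [|m IH].
  by apply: (polylim_ext _ (@polylim_cst B 1)) => z _; rewrite expr0.
have h1 : polylim B (fun z => 1 + f z / k).
  by apply: polylimD; [exact: polylim_cst|apply: (polylimM Br hf); exact: polylim_cst].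
by apply: polylim_ext (polylimM Br h1 IH) => z _; rewrite exprS.
Qed.

Lemma psumE (c : nat -> C) n z : (psum c n).[z] = \sum_(k < n) c k * z ^+ k.
Proof. by rewrite horner_poly. Qed.

Lemma sum_geo_le (x : R) m n : 0 <= x -> x < 1 ->
  \sum_(m <= k < n) x ^+ k <= x ^+ m / (1 - x).
Proof.
move=> x0 x1; have [nm|/ltnW mn] := leqP n m.
  by rewrite big_geq // divr_ge0 ?exprn_ge0 // subr_ge0 ltW.
rewrite -{1}[m]add0n big_addn big_mkord.
under eq_bigr do rewrite exprD.
rewrite -mulr_suml mulrC ler_wpM2l ?exprn_ge0 //.
rewrite -[leRHS]mul1r ler_pdivlMr ?subr_gt0 // mulrC.
have := subrX1 x (n - m); have := exprn_ge0 (n - m) x0; lra.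
Qed.

Lemma geo_small (x e : R) : 0 <= x -> x < 1 -> 0 < e -> exists N, forall n, (N <= n)%N -> x ^+ n <= e.
Proof.
move=> x0 x1 e0; have := @cvg_expr _ x; rewrite ger0_norm // => /(_ x1).
move=> /cvgrPdist_lt/(_ e e0)[N _ hN]; exists N => n Nn.
by have := hN n Nn; rewrite /= sub0r normrN ger0_norm ?exprn_ge0 // => /ltW.
Qed.

Lemma psum_tail (c : nat -> C) (M r s : R) : 0 <= M -> 0 <= s -> s < r ->
  (forall k, cabs (c k) * r ^+ k <= M) ->
  forall m n z, (m <= n)%N -> cabs z <= s ->
  cabs ((psum c m).[z] - (psum c n).[z]) <= M * ((s / r) ^+ m / (1 - s / r)).
Proof.
move=> M0 s0 sr cM m n z mn zs.
have r0 : 0 < r by exact: le_lt_trans sr.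
have q0 : 0 <= s / r by rewrite divr_ge0 // ltW.
have q1 : s / r < 1 by rewrite ltr_pdivrMr // mul1r.
rewrite !psumE -!(big_mkord predT (fun k => c k * z ^+ k)) (@big_cat_nat _ _ _ m 0%N n) //=.
rewrite opprD addNKr cabsN (le_trans (cabs_sum _ _ _)) //.
apply: le_trans (ler_wpM2l M0 (sum_geo_le m n q0 q1)); rewrite mulr_sumr.
apply: ler_sum => k _; rewrite cabsM cabsX expr_div_n mulrA.
rewrite ler_pdivlMr ?exprn_gt0 // mulrAC ler_pM ?mulr_ge0 ?exprn_ge0 ?cabs_ge0 ?cM ?(ltW r0) //.
by rewrite lerXn2r ?nnegrE ?cabs_ge0.
Qed.

Lemma useries_polylim c b r f : useries c b r f -> polylim (cball b r) f.
Proof.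
move=> h e /h[N hN]; exists (psum c N \Po ('X - b%:P)) => z Bz.
by rewrite horner_comp hornerXsubC hN.
Qed.

Lemma useries_le c b r s f : s <= r -> useries c b r f -> useries c b s f.
Proof.
move=> sr h e /h[N hN]; exists N => n Nn z zs; apply: hN => //.
exact: le_trans sr.
Qed.

(** When the coefficients are bounded by $M r^{-k}$, the tails of the series are
    dominated by a geometric one. It is therefore enough that some partial sums of
    arbitrarily large order come close to [f] at each point. *)
Lemma psum_uniform c b f (M r s : R) : 0 <= M -> 0 <= s -> s < r ->
  (forall k, cabs (c k) * r ^+ k <= M) ->
  (forall z, cball b s z -> forall e, 0 < e ->
     forall m, exists2 n, (m <= n)%N & cabs ((psum c n).[z - b] - f z) <= e) ->
  useries c b s f.
Proof.
move=> M0 s0 sr cM h e e0.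
have r0 : 0 < r by exact: le_lt_trans sr.
have q0 : 0 <= s / r by rewrite divr_ge0 // ltW.
have q1 : s / r < 1 by rewrite ltr_pdivrMr // mul1r.
have e2 : 0 < e / 2 by rewrite divr_gt0.
have K0 : 0 < (M + 1) / (1 - s / r) by rewrite divr_gt0 ?subr_gt0 // ltr_wpDl.
have [N hN] := geo_small q0 q1 (divr_gt0 e2 K0).
exists N => m Nm z zs; have [n mn hn] := h z zs _ e2 m.
rewrite (le_trans (cabs_triangle (psum c n).[z - b] _ _)) // [e]splitr lerD //.
rewrite (le_trans (psum_tail M0 s0 sr cM mn zs)) //.
have := hN m Nm; rewrite ler_pdivlMr //; apply: le_trans.
rewrite mulrCA ler_wpM2l ?exprn_ge0 //.
by rewrite ler_wpM2r ?lerDl // invr_ge0 subr_ge0 ltW.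
Qed.

Lemma cball_center b (r : R) : 0 <= r -> cball b r b.
Proof. by rewrite /cball /= subrr cabs0. Qed.

(** A uniform limit of polynomials is the sum of a power series: by the Cauchy
    estimates the coefficients of the approximants converge. *)
Lemma polylim_series b r f : 0 < r -> polylim (cball b r) f ->
  exists c, forall s, 0 <= s -> s < r -> useries c b s f.
Proof.
move=> r0 hf.
have /choice[p hp] : forall k, exists p, forall z, cball b r z ->
  cabs (p.[z] - f z) <= k.+1%:R^-1 by move=> k; apply/hf; rewrite invr_gt0 ltr0n.
have inv_noninc k l : (k <= l)%N -> l.+1%:R^-1 <= k.+1%:R^-1 :> R.
  by move=> kl; rewrite lef_pV2 ?posrE ?ltr0n // ler_nat.
have pp k l z : (k <= l)%N -> cball b r z -> cabs ((p k - p l).[z]) <= k.+1%:R^-1 *+ 2.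
  move=> kl Bz; rewrite hornerD hornerN (le_trans (cabs_triangle (f z) _ _)) // mulr2n.
  rewrite lerD ?hp // cabs_distC (le_trans (hp _ _ Bz)) //; exact: inv_noninc.
have co n k l : (k <= l)%N ->
  cabs ((p k)^`N(n).[b] - (p l)^`N(n).[b]) <= k.+1%:R^-1 *+ 2 / r ^+ n.
  move=> kl; rewrite ler_pdivlMr ?exprn_gt0 //.
  rewrite -hornerN -hornerD -nderivnB; apply: cauchy_nderivn (ltW r0) _ => z Bz.
  exact: pp.
have b0 n : (k.+1%:R^-1 *+ 2 / r ^+ n : R) @[k --> \oo] --> 0.
  rewrite -[X in _ --> X](mul0r (r ^+ n)^-1); apply: cvgMr_tmp.
  by rewrite -[X in _ --> X](mul0rn R 2); apply: cvgMn; exact: cvg_harmonic.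
have /choice[c hc] n := ccomplete (b0 n) (co n).
exists c => s s0 sr.
have q0 : 0 <= s / r by rewrite divr_ge0 // ltW.
have q1 : s / r < 1 by rewrite ltr_pdivrMr // mul1r.
have cd n k : cabs ((p k)^`N(n).[b] - c n) * r ^+ n <= 4 * k.+1%:R^-1.
  rewrite -ler_pdivlMr ?exprn_gt0 // (le_trans (hc n k)) //.
  by rewrite -!mulrnAl -mulrnA mulr_natl.
pose L := `|pbound (p 0%N) (r + cabs b)|.
have L0 : 0 <= L by exact: normr_ge0.
have cM n : cabs (c n) * r ^+ n <= L + 4.
  have h1 : cabs (p 0%N)^`N(n).[b] * r ^+ n <= L.
    apply: cauchy_nderivn (ltW r0) _ => z zr.
    by rewrite (le_trans _ (ler_norm _)) //; apply/pboundP/cball_le.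
  have h2 := cd n 0%N; rewrite invr1 mulr1 in h2.
  rewrite (le_trans _ (lerD h1 h2)) // -mulrDl ler_wpM2r ?exprn_ge0 ?(ltW r0) //.
  have := cabs_triangle (p 0%N)^`N(n).[b] (c n) 0.
  by rewrite !subr0 [cabs (c n - _)]cabs_distC addrC.
apply: (psum_uniform _ s0 sr cM) => [|z zs e e0 m]; first by rewrite addr_ge0.
pose K := 4 / (1 - s / r) + 1.
have K0 : 0 < K by rewrite ltr_wpDl // divr_ge0 // subr_ge0 ltW.
pose k := Num.truncn (K / e).
have kK : K * k.+1%:R^-1 <= e.
  by rewrite ler_pdivrMr ?ltr0n // mulrC -ler_pdivrMr // ltW // truncnS_gt.
exists (maxn m (size (p k))); first by rewrite leq_maxl.
rewrite (le_trans (cabs_triangle (p k).[z] _ _)) // (le_trans _ kK) // mulrDl mul1r.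
rewrite lerD ?hp //; last exact: le_trans (ltW sr).
rewrite -[z in (p k).[z]](subrKC b) psumE.
rewrite (@nderiv_taylor_wide _ (maxn m (size (p k)))) ?leq_maxr //; last exact: mulrC.
rewrite -sumrB (le_trans (cabs_sum _ _ _)) //.
set N := maxn _ _.
rewrite mulrAC; apply: (@le_trans _ _ (4 * k.+1%:R^-1 * \sum_(0 <= i < N) (s / r) ^+ i)); last first.
  by rewrite ler_wpM2l ?mulr_ge0 ?invr_ge0 ?ler0n //
    (le_trans (sum_geo_le _ _ q0 q1)) // expr0 mul1r.
rewrite mulr_sumr big_mkord; apply: ler_sum => i _.
rewrite -mulrBl cabsM cabsX [cabs (c i - _)]cabs_distC expr_div_n.
rewrite mulrA ler_pdivlMr ?exprn_gt0 // mulrAC ler_pM ?mulr_ge0 ?exprn_ge0 ?cabs_ge0 ?cd ?(ltW r0) //.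
by rewrite lerXn2r ?nnegrE ?cabs_ge0.
Qed.

(** The identity principle: the Cauchy estimates on the small ball show that
    every coefficient of the power series vanishes. *)
Lemma polylim_identity b (r s : R) f : 0 < s -> s <= r -> polylim (cball b r) f ->
  (forall z, cball b s z -> f z = 0) -> forall z, cabs (z - b) < r -> f z = 0.
Proof.
move=> s0 sr /(polylim_series (lt_le_trans s0 sr))[c hc] f0 z zr.
have c0 k : c k = 0.
  apply: cabs_eq0; apply/eqP; rewrite eq_le cabs_ge0 andbT.
  have t0 : 0 < s / 2 by rewrite divr_gt0.
  have tr : s / 2 < r by rewrite (lt_le_trans _ sr) // gtr_pMr // invf_lt1 ?ltr1n.
  have h (e : R) : 0 < e -> cabs (c k) * (s / 2) ^+ k <= e.
    move=> /(hc _ (ltW t0) tr)[N hN].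
    have -> : c k = (psum c (maxn N k.+1))`_k by rewrite coef_poly leq_max ltnSn orbT.
    apply: cauchy_coef (ltW t0) _ => w wt.
    have /= := hN (maxn N k.+1) (leq_maxl _ _) (w + b).
    rewrite /cball /= addrK wt => /(_ (lexx _)); rewrite f0 ?subr0 //.
    by rewrite /cball /= addrK wt ler_pdivrMr // ler_peMr ?ler1n // ltW.
  have : cabs (c k) * (s / 2) ^+ k <= 0 by apply/ler_addgt0Pr => e /h; rewrite add0r.
  by rewrite pmulr_lle0 ?exprn_gt0.
apply: cabs_eq0; apply/eqP; rewrite eq_le cabs_ge0 andbT.
apply/ler_addgt0Pr => e /(hc _ (cabs_ge0 _) zr)[N /(_ N (leqnn _) z (lexx _))].
by rewrite psumE big1 ?sub0r ?cabsN ?add0r // => i _; rewrite c0 mul0r.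
Qed.

Lemma useries_unique c d b (s : R) f : 0 < s -> useries c b s f -> useries d b s f -> c =1 d.
Proof.
move=> s0 hc hd k; apply/eqP; rewrite -subr_eq0; apply/eqP/cabs_eq0/eqP.
rewrite eq_le cabs_ge0 andbT -(pmulr_lle0 _ (exprn_gt0 k s0)).
apply/ler_addgt0Pr => e e0; rewrite add0r.
have e2 : 0 < e / 2 by rewrite divr_gt0.
have [N hN] := hc _ e2; have [N' hN'] := hd _ e2.
pose n := maxn (maxn N N') k.+1.
have nN : (N <= n)%N by rewrite !leq_max leqnn.
have nN' : (N' <= n)%N by rewrite !leq_max leqnn orbT.
have -> : c k - d k = (psum c n - psum d n)`_k.
  by rewrite coefB !coef_poly leq_max ltnSn orbT.
apply: cauchy_coef (ltW s0) _ => z zs.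
have zb : cball b s (z + b) by rewrite /cball /= addrK zs.
rewrite hornerD hornerN (le_trans (cabs_triangle (f (z + b)) _ _)) //.
have := hN n nN _ zb; have := hN' n nN' _ zb; rewrite addrK => h1 h2.
by rewrite [e]splitr lerD // cabs_distC.
Qed.

End PolynomialLimits.

(** * Analytic functions on the disk have a global Taylor series *)

Section Weierstrass.
Variable R : realType.
Local Notation C := R[i].
Implicit Types (z w b : C) (p q : {poly C}) (f g : C -> C).

Lemma seriesE (c : nat -> C) b z n :
  series (fun k => c k * (z - b) ^+ k : R[i]^o) n = (psum c n).[z - b].
Proof. by rewrite psumE /series /= big_mkord. Qed.

Lemma polylim_analytic f :
  (forall b, disk b -> exists2 r : R, 0 < r & polylim (cball b r) f) -> analytic_on_disk f.
Proof.
move=> h b /h[r r0 /(polylim_series r0)[c hc]]; exists r => //; exists c => z zr.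
apply/ccvgP => e e0; have e2 : 0 < e / 2 by rewrite divr_gt0.
have [N hN] := hc _ (cabs_ge0 _) zr _ e2; exists N => n Nn.
rewrite seriesE (le_lt_trans (hN n Nn z (lexx _))) //.
by rewrite gtr_pMr // invf_lt1 ?ltr1n.
Qed.

(** Convergence at one point at distance $3r/4$ from the centre bounds the terms
    there, which makes the convergence uniform on the ball of radius $r/2$. *)
Lemma analytic_useries f b : analytic_on_disk f -> disk b ->
  exists2 r : R, 0 < r & exists c, useries c b r f.
Proof.
move=> h /h[r r0 [c hc]].
have hz z : cabs (z - b) < r -> forall e : R, 0 < e ->
    exists N, forall n, (N <= n)%N -> cabs ((psum c n).[z - b] - f z) < e.
  move=> /hc/ccvgP hcz e /hcz[N hN]; exists N => n /hN.
  by rewrite seriesE.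
pose t := r * (3 / 4).
have t0 : 0 < t by rewrite mulr_gt0 // divr_gt0.
have tr : t < r by rewrite /t; lra.
exists (r / 2); first by rewrite divr_gt0.
exists c.
pose z1 := b + t%:C.
have z1b : z1 - b = t%:C by rewrite /z1 addrAC subrr add0r.
have [|N hN] := hz z1 _ 1 ltr01; first by rewrite z1b cabs_real gtr0_norm.
have termE k : cabs (c k) * t ^+ k = cabs ((psum c k.+1).[z1 - b] - (psum c k).[z1 - b]).
  by rewrite !psumE big_ord_recr /= addrAC subrr add0r z1b cabsM cabsX cabs_real gtr0_norm.
pose M := \sum_(k < N) cabs (c k) * t ^+ k + 2.
have S0 : 0 <= \sum_(k < N) cabs (c k) * t ^+ k.
  by apply: sumr_ge0 => i _; rewrite mulr_ge0 ?cabs_ge0 ?exprn_ge0 ?ltW.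
have cM k : cabs (c k) * t ^+ k <= M.
  have [kN|Nk] := ltnP k N.
    rewrite /M (bigD1 (Ordinal kN)) //= -addrA lerDl addr_ge0 //.
    by apply: sumr_ge0 => i _; rewrite mulr_ge0 ?cabs_ge0 ?exprn_ge0 ?ltW.
  rewrite termE (le_trans (cabs_triangle (f z1) _ _)) // (@le_trans _ _ 2) ?lerDr //.
  rewrite -[2](natrD _ 1 1) lerD // ltW //; first by apply: hN; apply: leqW.
  by rewrite cabs_distC hN.
have M0 : 0 <= M by rewrite addr_ge0.
apply: (psum_uniform M0 _ _ cM); rewrite ?divr_ge0 ?(ltW r0) //.
  by rewrite /t; lra.
move=> z zr e e0 m.
have [|N' hN'] := hz z _ e e0.
  by rewrite (le_lt_trans zr) // gtr_pMr // invf_lt1 ?ltr1n.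
by exists (maxn m N'); rewrite ?leq_maxl // ltW // hN' // leq_maxr.
Qed.

Lemma cball_sub b b' (r r' : R) : cabs (b - b') + r <= r' -> cball b r `<=` cball b' r'.
Proof.
move=> h z zb; rewrite /cball /= (le_trans (cabs_triangle b _ _)) //.
by rewrite (le_trans _ h) // addrC lerD2l.
Qed.

(** Compactness of the square $[-1,1]^2$ makes the local radii uniform. Points
    outside the open disk have a neighbourhood avoiding the subdisk, so the condition
    there is void. *)
Lemma uniform_radius f (r : R) : analytic_on_disk f -> r < 1 ->
  exists2 d : R, 0 < d & forall b, cabs b <= r -> polylim (cball b d) f /\
    forall z, cball b d z -> cabs (f z) <= d^-1.
Proof.
move=> fa r1.
pose K := (`[-1, 1]%classic `*` `[-1, 1]%classic : set (R * R)).
have cK : compact K by apply: compact_setX; exact: segment_compact.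
pose P (d : R) (x : R * R) := cabs (x.1 +i* x.2) <= r ->
  polylim (cball (x.1 +i* x.2) d) f /\ forall z, cball (x.1 +i* x.2) d z -> cabs (f z) <= d^-1.
have dist (x y : R * R) (e : R) : ball x e y -> cabs ((y.1 +i* y.2) - (x.1 +i* x.2)) <= e + e.
  move=> [/= h1 h2]; rewrite (le_trans (cabs_le_Re_Im _)) //= lerD // ltW //.
    by rewrite distrC; exact: h1.
  by rewrite distrC; exact: h2.
have : \forall d \near 0^'+, K `<=` P d.
  apply: (iffLR (compact_near_coveringP K) cK _ (0^'+) P) => x _.
  have [x1|x1] := ltP (cabs (x.1 +i* x.2)) 1.
    have [d d0 [c /useries_polylim hd]] := analytic_useries fa x1.
    have [M M0 fM] := polylim_bounded (@cball_le _ _ _) hd.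
    pose m := Num.min (d / 2) M^-1.
    have m0 : 0 < m by rewrite lt_min divr_gt0 // invr_gt0.
    exists (ball x (d / 4), [set e | 0 < e < m]) => /=.
      split; first by apply: nbhsx_ballx; rewrite divr_gt0.
      near=> e; apply/andP; split; first by near: e; exact: nbhs_right_gt.
      by near: e; exact: nbhs_right_lt.
    move=> [y e] /= [/dist yx /andP[e0 em]] _.
    have sub : cball (y.1 +i* y.2) e `<=` cball (x.1 +i* x.2) d.
      apply: cball_sub; have : e < d / 2 by rewrite (lt_le_trans em) // ge_min lexx.
      lra.
    split; first exact: polylim_sub hd.
    move=> z /sub/fM/le_trans; apply.
    rewrite -[M]invrK lef_pV2 ?posrE ?invr_gt0 // ltW // (lt_le_trans em) //.
    by rewrite ge_min lexx orbT.
  exists (ball x ((1 - r) / 4), setT) => /=.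
    by split; [apply: nbhsx_ballx; rewrite divr_gt0 // subr_gt0|exact: filterT].
  move=> [y e] /= [/dist yx _] yr.
  have := cabs_triangle (y.1 +i* y.2) (x.1 +i* x.2) 0.
  rewrite !subr0 cabs_distC; lra.
move=> h; have : \forall d \near (0 : R)^'+, 0 < d /\ K `<=` P d.
  by apply: filterS2 (nbhs_right_gt 0) h => d d0 dK; split.
move=> /filter_ex[d [d0 dK]]; exists d => // -[x y] br.
apply: (dK (x, y)) => //; have := le_trans br (ltW r1) => b1.
by split; rewrite /= in_itv /= -ler_norml; apply: le_trans b1;
  [exact: Re_le_cabs (x +i* y)|exact: Im_le_cabs (x +i* y)].
Unshelve. all: by end_near. Qed.

(** The derivatives at points of modulus $R_0 - \rho/4$ obey Cauchy estimates of
    radius $\rho$; a second Cauchy estimate, for the derivatives themselves as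
    functions of the centre, then bounds the Taylor coefficients at $0$ well
    enough for convergence up to $R_0 + \rho/4$. *)
Lemma coef_bound f a (rho M R0 r : R) : 0 < rho -> rho <= R0 -> R0 <= r ->
  (forall b, cabs b <= r -> polylim (cball b rho) f /\
    forall z, cball b rho z -> cabs (f z) <= M) ->
  (forall s, 0 <= s -> s < R0 -> useries a 0 s f) ->
  forall k, cabs (a k) * (R0 + rho / 4) ^+ k <= (M + 1) * 2.
Proof.
move=> rho0 rhoR R0r hf ha k.
pose r1 := R0 - rho / 4.
have r1_gt0 : 0 < r1 by rewrite /r1; lra.
have cr : cabs (r1%:C) = r1 by rewrite cabs_real gtr0_norm.
have M0 : 0 <= M.
  have [|_ /(_ r1%:C)] := hf r1%:C; first by rewrite cr /r1; lra.
  by move=> h; apply: le_trans (cabs_ge0 _) (h _); apply/cball_center/ltW.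
have main n : (n <= k)%N -> cabs (a k) * r1 ^+ (k - n) * rho ^+ n *+ 'C(k, n) <= M + 1.
  move=> nk.
  (* the error [e] is magnified by [8 ^+ n] when the Cauchy estimate of radius
     [rho / 8] is compared with the one of radius [rho] *)
  pose e := (1 + 2 * 8 ^+ n : R)^-1.
  have e1 : 0 < 1 + 2 * 8 ^+ n :> R by rewrite ltr_wpDr // mulr_ge0 ?exprn_ge0.
  have e0 : 0 < e by rewrite invr_gt0.
  have s0 : 0 <= R0 - rho / 8 by lra.
  have [|N hN] := ha _ s0 _ e e0; first by lra.
  pose m := maxn N k.+1.
  have h b : cabs b = r1 -> cabs ((psum a m)^`N(n)).[b] <= (M + 1) / rho ^+ n.
    move=> br; rewrite ler_pdivlMr ?exprn_gt0 //.
    have [|hb bM] := hf b; first by rewrite br /r1; lra.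
    have [q hq] := hb e e0.
    have h1 : cabs q^`N(n).[b] * rho ^+ n <= M + e.
      apply: cauchy_nderivn (ltW rho0) _ => z zb.
      have := cabs_le_add (q.[z] - f z) (f z); rewrite subrK => /le_trans; apply.
      by rewrite addrC lerD ?bM ?hq.
    have h2 : cabs (psum a m - q)^`N(n).[b] * (rho / 8) ^+ n <= e + e.
      apply: cauchy_nderivn => [|z zb]; first by lra.
      rewrite hornerD hornerN (le_trans (cabs_triangle (f z) _ _)) // lerD //.
        rewrite -[z in (psum a m).[z]]subr0 hN ?leq_maxl // /cball /= subr0.
        have := cabs_le_add (z - b) b; rewrite subrK br /r1; lra.
      by rewrite cabs_distC hq // /cball /=; lra.
    have h3 : cabs (psum a m - q)^`N(n).[b] * rho ^+ n <= (e + e) * 8 ^+ n.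
      rewrite -ler_pdivrMr ?exprn_gt0 //; apply: le_trans h2.
      by rewrite expr_div_n mulrA.
    apply: (@le_trans _ _ ((M + e) + (e + e) * 8 ^+ n)).
      rewrite (le_trans _ (lerD h1 h3)) // -mulrDl ler_wpM2r ?exprn_ge0 ?(ltW rho0) //.
      have := cabs_le_add q^`N(n).[b] (psum a m - q)^`N(n).[b].
      by rewrite -hornerD nderivnB addrC subrK.
    rewrite -addrA lerD2l -[leRHS](mulVf (lt0r_neq0 e1)) -/e; lra.
  have := cauchy_coef (k - n) (ltW r1_gt0) h.
  rewrite coef_nderivn subnKC // cabsMn coef_poly leq_max ltnSn orbT.
  by rewrite ler_pdivlMr ?exprn_gt0 // -!mulrnAl.
have -> : R0 + rho / 4 = r1 + rho / 2 by rewrite /r1; lra.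
rewrite exprDn mulr_sumr.
apply: (@le_trans _ _ (\sum_(0 <= n < k.+1) (M + 1) * (1 / 2) ^+ n)).
  rewrite big_mkord; apply: ler_sum => n _.
  have -> : cabs (a k) * (r1 ^+ (k - n) * (rho / 2) ^+ n *+ 'C(k, n)) =
      cabs (a k) * r1 ^+ (k - n) * rho ^+ n *+ 'C(k, n) * (1 / 2) ^+ n.
    rewrite (_ : rho / 2 = rho * (1 / 2)); last by rewrite mul1r.
    by rewrite exprMn !mulrnAr mulrnAl !mulrA.
  by rewrite ler_wpM2r ?exprn_ge0 ?divr_ge0 // main // -ltnS.
rewrite -mulr_sumr ler_wpM2l ?addr_ge0 //.
apply: le_trans (sum_geo_le _ _ _ _) _; rewrite ?expr0; [lra|lra|].
by rewrite ler_pdivrMr; lra.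
Qed.

(** The coefficient bound gives convergence of the Taylor series at $0$ beyond
    $R_0$. A point $z$ of modulus between $R_0$ and $R_0 + \rho/16$ lies at
    distance $\rho/2$ from a point $b$ on the same ray, around which the function and
    the sum of the series agree; the identity principle on the ball of radius
    $17\rho/32$ around $b$, still inside both domains, carries the equality to $z$. *)
Lemma extend_step f a (rho M R0 r : R) : 0 < rho -> rho <= R0 -> R0 <= r ->
  (forall b, cabs b <= r -> polylim (cball b rho) f /\
    forall z, cball b rho z -> cabs (f z) <= M) ->
  (forall s, 0 <= s -> s < R0 -> useries a 0 s f) ->
  forall s, 0 <= s -> s < R0 + rho / 16 -> useries a 0 s f.
Proof.
move=> rho0 rhoR R0r hf ha.
have aM := coef_bound rho0 rhoR R0r hf ha.
have M0 : 0 <= M.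
  have [|_ /(_ 0)] := hf 0; first by rewrite cabs0; lra.
  by move=> h; apply: le_trans (cabs_ge0 _) (h _); apply/cball_center/ltW.
have M1 : 0 <= (M + 1) * 2 by rewrite mulr_ge0 // addr_ge0.
pose T := R0 + rho / 4.
have T0 : 0 < T by rewrite /T; lra.
have /choice[g hg] : forall z, exists l, cabs z < T -> forall e : R, 0 < e ->
    exists N, forall n, (N <= n)%N -> cabs ((psum a n).[z] - l) <= e.
  move=> z; have [zT|] := ltP (cabs z) T; last by exists 0.
  have q0 : 0 <= cabs z / T by rewrite divr_ge0 ?cabs_ge0 ?ltW.
  have q1 : cabs z / T < 1 by rewrite ltr_pdivrMr // mul1r.
  pose B k := (M + 1) * 2 * ((cabs z / T) ^+ k / (1 - cabs z / T)).
  have B0 : B k @[k --> \oo] --> 0.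
    rewrite -(mulr0 ((M + 1) * 2)); apply: cvgMl_tmp.
    rewrite -[X in _ --> X](mul0r (1 - cabs z / T)^-1); apply: cvgMr_tmp.
    by apply: cvg_expr; rewrite ger0_norm.
  have [l hl] := ccomplete B0 (fun k l kl => psum_tail M1 (cabs_ge0 z) zT aM kl (lexx _)).
  exists l => _ e e0.
  have e2 : 0 < e / 2 by rewrite divr_gt0.
  move/cvgrPdist_lt : B0 => /(_ _ e2)[N _ hN]; exists N => n Nn.
  have Bn : B n <= e / 2.
    have := hN n Nn; rewrite /= sub0r normrN => /ltW; exact/le_trans/ler_norm.
  by rewrite (le_trans (hl n)) // -mulr_natr; lra.
have gs s : 0 <= s -> s < T -> useries a 0 s g.
  move=> s0 sT; apply: (psum_uniform M1 s0 sT aM) => z; rewrite /cball /= subr0 => zs e e0 m.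
  have [N hN] := hg z (le_lt_trans zs sT) e e0.
  by exists (maxn m N); rewrite ?leq_maxl // hN // leq_maxr.
have fg0 z : cabs z < R0 -> f z = g z.
  move=> zR; apply/eqP; rewrite -subr_eq0; apply/eqP/cabs_eq0/eqP.
  rewrite eq_le cabs_ge0 andbT; apply/ler_addgt0Pr => e e0; rewrite add0r.
  have e2 : 0 < e / 2 by rewrite divr_gt0.
  have [N hN] := ha _ (cabs_ge0 z) zR _ e2.
  have [|N' hN'] := gs _ (cabs_ge0 z) _ _ e2; first by rewrite (lt_trans zR) // /T; lra.
  have zz : cball 0 (cabs z) z by rewrite /cball /= subr0.
  rewrite (le_trans (cabs_triangle (psum a (maxn N N')).[z - 0] _ _)) // [e]splitr.
  rewrite lerD // ?hN' ?leq_maxr //.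
  by rewrite cabs_distC hN ?leq_maxl.
have fg z : cabs z < R0 + rho / 16 -> f z = g z.
  move=> zR; have [zR0|zR0] := ltP (cabs z) R0; first exact: fg0.
  have z0 : 0 < cabs z by lra.
  pose b := z * (1 - rho / 2 / cabs z)%:C.
  have bE : cabs b = cabs z - rho / 2.
    rewrite /b cabsM cabs_real ger0_norm; first by field; rewrite lt0r_neq0.
    by rewrite subr_ge0 ler_pdivrMr // mul1r; lra.
  have zbE : cabs (z - b) = rho / 2.
    have -> : z - b = z * (rho / 2 / cabs z)%:C.
      by rewrite /b rmorphB /= mulrBr mulr1 subKr.
    rewrite cabsM cabs_real ger0_norm ?divr_ge0 ?(ltW rho0) ?cabs_ge0 //.
    by field; rewrite lt0r_neq0.
  have [|fb _] := hf b; first by rewrite bE; lra.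
  have t0 : 0 <= cabs b + rho * (17 / 32) by rewrite bE; lra.
  have tT : cabs b + rho * (17 / 32) < T by rewrite bE /T; lra.
  have gb : polylim (cball b (rho * (17 / 32))) g.
    apply: polylim_sub (useries_polylim (gs _ t0 tT)).
    by apply: cball_sub; rewrite subr0.
  have db : polylim (cball b (rho * (17 / 32))) (fun z => f z + -1 * g z).
    apply: polylimD.
      by apply: polylim_sub fb; apply: cball_sub; rewrite subrr cabs0; lra.
    by apply: (polylimM (@cball_le _ _ _) _ gb); exact: polylim_cst.
  suff : f z + -1 * g z = 0 by rewrite mulN1r => /eqP; rewrite subr_eq0 => /eqP.
  apply: (polylim_identity (s := rho / 8) _ _ db); [lra|lra| |by rewrite zbE; lra].
  move=> w wb; rewrite fg0 ?mulN1r ?subrr //.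
  have := cabs_le_add (w - b) b; rewrite subrK bE.
  by move: wb; rewrite /cball /=; lra.
move=> s s0 sR; have sT : s < T by rewrite /T; lra.
move=> e /(gs s s0 sT)[N hN]; exists N => n Nn z zs.
by rewrite fg ?hN // (le_lt_trans _ sR) //; move: zs; rewrite /cball /= subr0.
Qed.

(** On a subdisk of radius $r$ the admissible step $\rho/16$ is constant, so
    finitely many extensions reach $r$. *)
Theorem global_taylor f : analytic_on_disk f ->
  exists a, forall s, 0 <= s -> s < 1 -> useries a 0 s f.
Proof.
move=> fa; have d0 : disk (0 : C) by rewrite /disk /= cabs0 ltr01.
have [r0 r0_gt0 [a ha]] := analytic_useries fa d0.
exists a => s s0 s1.
pose r := (s + 1) / 2.
have sr : s < r by rewrite /r; lra.
have r1 : r < 1 by rewrite /r; lra.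
have [d d_gt0 hd] := uniform_radius fa r1.
pose rho := Num.min d r.
have rho0 : 0 < rho by rewrite lt_min d_gt0 /r; lra.
have rhor : rho <= r by rewrite ge_min lexx orbT.
have rhod : rho <= d by rewrite ge_min lexx.
have hf b : cabs b <= r -> polylim (cball b rho) f /\
    forall z, cball b rho z -> cabs (f z) <= d^-1.
  move=> /hd[h1 h2]; have sub : cball b rho `<=` cball b d.
    by apply: cball_sub; rewrite subrr cabs0 add0r.
  by split; [exact: polylim_sub h1|move=> z /sub/h2].
have base t : 0 <= t -> t < rho -> useries a 0 t f.
  have [|h0 _] := hf 0; first by rewrite cabs0; lra.
  have [c hc] := polylim_series rho0 h0.
  suff -> : a = c by exact: hc.
  apply: funext; pose u := Num.min r0 (rho / 2).
  have u0 : 0 < u by rewrite lt_min r0_gt0; lra.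
  apply: (useries_unique (s := u) u0).
    by apply: useries_le ha; rewrite ge_min lexx.
  apply: hc; first exact: ltW.
  by rewrite /u gt_min; apply/orP; right; lra.
have step j t : 0 <= t -> t < Num.min (rho + j%:R * (rho / 16)) r -> useries a 0 t f.
  elim: j t => [|j IH] t t0.
    by rewrite mul0r addr0 lt_min => /andP[tr _]; exact: base.
  move=> tj; apply: (extend_step rho0 _ _ hf IH t0).
  - by rewrite le_min rhor lerDl mulr_ge0 ?divr_ge0 // ltW.
  - by rewrite ge_min lexx orbT.
  - move: tj; rewrite lt_min -natr1 mulrDl mul1r addrA => /andP[t1 t2].
    by case: (leP (rho + j%:R * (rho / 16)) r) => _ //; rewrite (lt_trans t2) // ltrDl divr_gt0.
pose j := Num.truncn (r / (rho / 16)).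
apply: (step j.+1) => //; rewrite lt_min sr andbT (lt_trans sr) // ltr_wpDl ?(ltW rho0) //.
by rewrite -ltr_pdivrMr ?divr_gt0 // truncnS_gt.
Qed.

End Weierstrass.

(** * Rotation invariance of planar Lebesgue measure *)

Section Rotation.
Variable R : realType.
Local Notation C := R[i].
Local Notation line := (measurableTypeR R).
Local Notation plane := (line * line)%type.
Local Notation leb := (@lebesgue_measure R).
Local Notation leb2 := (leb \x leb)%E.

Lemma measurable_shift (a : R) : measurable_fun setT ((fun x => x + a) : line -> line).
Proof. by apply: measurable_funD => //; exact: measurable_cst. Qed.

Lemma lebesgue_shift (a : R) (A : set line) : measurable A ->
  pushforward leb ((fun x => x + a) : line -> line) A = leb A.
Proof.
move=> mA; pose mf := @measurable_shift a.
pose f : {mfun line >-> line} := HB.pack ((fun x => x + a) : line -> line)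
  (isMeasurableFun.Build _ _ line line _ mf).
apply/esym; apply: (lebesgue_measure_unique (mu := pushforward leb f)) => //= _ [[x y] _ <-] /=.
rewrite /pushforward /=.
rewrite (_ : _ @^-1` _ = `]x - a, y - a]%classic); last first.
  by apply/seteqP; split => z /=; rewrite !in_itv /= ltrBlDr lerBrDr.
by rewrite !lebesgue_measure_itv /= !lte_fin ltrD2r -!EFinD opprD opprK addrACA addNr addr0.
Qed.

Lemma integral_shift (a : R) (f : line -> \bar R) : measurable_fun setT f ->
  (forall x, 0 <= f x)%E ->
  (\int[leb]_x f (x + a)%R = \int[leb]_x f x)%E.
Proof.
move=> mf f0.
pose g : line -> line := fun x => x + a.
transitivity (\int[leb]_(x in g @^-1` setT) (f \o g) x)%E; first by rewrite preimage_setT.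
rewrite -(ge0_integral_pushforward (measurable_shift a) leb measurableT mf) //.
apply: eq_measure_integral => [|ms A mA _]; first exact: measurable_shift.
exact: lebesgue_shift.
Qed.

Lemma measurable_fst_shear (a : R) :
  measurable_fun setT ((fun z => (z.1 + a * z.2, z.2)) : plane -> plane).
Proof.
apply/measurable_fun_pairP; split; last exact: measurable_snd.
apply: measurable_funD; first exact: measurable_fst.
by apply: measurable_funM; [exact: measurable_cst|exact: measurable_snd].
Qed.

Lemma measurable_snd_shear (a : R) :
  measurable_fun setT ((fun z => (z.1, z.2 + a * z.1)) : plane -> plane).
Proof.
apply/measurable_fun_pairP; split; first exact: measurable_fst.
apply: measurable_funD; first exact: measurable_snd.
by apply: measurable_funM; [exact: measurable_cst|exact: measurable_fst].
Qed.

(** On each horizontal line a shear is a translation, so Tonelli's theorem reduces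
    its invariance to that of Lebesgue measure on the line. *)
Lemma integral_fst_shear (a : R) (f : plane -> \bar R) : measurable_fun setT f ->
  (forall z, 0 <= f z)%E ->
  (\int[leb2]_z f (z.1 + a * z.2, z.2)%R = \int[leb2]_z f z)%E.
Proof.
move=> mf f0.
have mg : measurable_fun setT (fun z : plane => f (z.1 + a * z.2, z.2)).
  exact: (measurableT_comp mf (@measurable_fst_shear a)).
rewrite (fubini_tonelli2 _ mg) // (fubini_tonelli2 _ mf) //.
apply: eq_integral => y _; rewrite /fubini_G /=.
apply: (@integral_shift (a * y) (fun x => f (x, y))) => //.
exact: measurableT_comp mf (measurable_pair2 y).
Qed.

Lemma integral_snd_shear (a : R) (f : plane -> \bar R) : measurable_fun setT f ->
  (forall z, 0 <= f z)%E ->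
  (\int[leb2]_z f (z.1, z.2 + a * z.1)%R = \int[leb2]_z f z)%E.
Proof.
move=> mf f0.
have mg : measurable_fun setT (fun z : plane => f (z.1, z.2 + a * z.1)).
  exact: (measurableT_comp mf (@measurable_snd_shear a)).
rewrite (fubini_tonelli1 _ mg) // (fubini_tonelli1 _ mf) //.
apply: eq_integral => x _; rewrite /fubini_F /=.
apply: (@integral_shift (a * x) (fun y => f (x, y))) => //.
exact: measurableT_comp mf (measurable_pair1 x).
Qed.

Definition rotation (c s : R) (z : plane) : plane :=
  (c * z.1 - s * z.2, s * z.1 + c * z.2).

Lemma measurable_rotation c s : measurable_fun setT (rotation c s).
Proof.
apply/measurable_fun_pairP; split.
  apply: measurable_funB; apply: measurable_funM;
    by [exact: measurable_cst|exact: measurable_fst|exact: measurable_snd].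
apply: measurable_funD; apply: measurable_funM;
    by [exact: measurable_cst|exact: measurable_fst|exact: measurable_snd].
Qed.

(** A rotation with nonzero sine is a product of three shears. *)
Lemma integral_rotation_neq0 (c s : R) (f : plane -> \bar R) : s != 0 ->
  c ^+ 2 + s ^+ 2 = 1 -> measurable_fun setT f -> (forall z, 0 <= f z)%E ->
  (\int[leb2]_z f (rotation c s z) = \int[leb2]_z f z)%E.
Proof.
move=> s0 cs mf f0; pose a := (c - 1) / s.
have as_ : a * s = c - 1 by rewrite /a divfK.
have ac : a * (c + 1) = - s.
  apply: (mulIf s0); rewrite mulrAC as_ mulNr -expr2.
  by rewrite -subr_sqr_1 -cs; ring.
pose f1 (z : plane) := f (z.1 + a * z.2, z.2).
pose f2 (z : plane) := f1 (z.1, z.2 + s * z.1).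
have mf1 : measurable_fun setT f1 := measurableT_comp mf (@measurable_fst_shear a).
have mf2 : measurable_fun setT f2 := measurableT_comp mf1 (@measurable_snd_shear s).
rewrite -(integral_fst_shear a mf f0) -(integral_snd_shear s mf1 (fun z => f0 _)).
rewrite -(integral_fst_shear a mf2 (fun z => f0 _)).
apply: eq_integral => z _; rewrite /f2 /f1 /rotation /=; congr (f (_, _)).
  transitivity (z.1 * (1 + a * s) + z.2 * (a + a * (1 + s * a))); last by ring.
  have -> : a + a * (1 + s * a) = - s by rewrite -ac [s * a]mulrC as_; ring.
  by rewrite as_; ring.
transitivity (s * z.1 + (1 + a * s) * z.2); last by ring.
by rewrite as_; ring.
Qed.

Lemma integral_rotation (c s : R) (f : plane -> \bar R) :
  c ^+ 2 + s ^+ 2 = 1 -> measurable_fun setT f -> (forall z, 0 <= f z)%E ->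
  (\int[leb2]_z f (rotation c s z) = \int[leb2]_z f z)%E.
Proof.
move=> cs mf f0; have [s0|s0] := eqVneq s 0; last exact: integral_rotation_neq0.
(* the remaining cases are the identity and the square of a quarter turn *)
have /eqP : c ^+ 2 = 1 by rewrite -cs s0 expr0n addr0.
rewrite sqrf_eq1 => /orP[]/eqP ->; rewrite s0.
  by apply: eq_integral => -[x y] _; rewrite /rotation /=; congr (f (_, _)); ring.
have q1 : (0 : R) ^+ 2 + 1 ^+ 2 = 1 by rewrite expr0n expr1n add0r.
have mq : measurable_fun setT (fun z => f (rotation 0 1 z)).
  exact: measurableT_comp mf (measurable_rotation _ _).
rewrite -(integral_rotation_neq0 (oner_neq0 _) q1 mf f0).
rewrite -(integral_rotation_neq0 (oner_neq0 _) q1 mq (fun z => f0 _)).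
by apply: eq_integral => -[x y] _; rewrite /rotation /=; congr (f (_, _)); ring.
Qed.

Lemma toC_rotation (w : C) (z : plane) :
  toC (rotation (complex.Re w) (complex.Im w) z) = w * toC z.
Proof.
case: w => c s; case: z => x y; apply/eqP; rewrite eq_complex /=.
by apply/andP; split; apply/eqP; ring.
Qed.

End Rotation.

(** * The weighted Bergman space and density of polynomials *)

Section WeightedSpace.
Variable R : realType.
Local Notation C := R[i].
Local Notation plane := (measurableTypeR R * measurableTypeR R)%type.
Local Notation leb := (@lebesgue_measure R).
Local Notation leb2 := (leb \x leb)%E.

Definition pdisk : set plane := @toC R @^-1` @disk R.

Lemma measurable_cabs : measurable_fun setT (fun w : plane => cabs (toC w)).
Proof.
rewrite (_ : (fun w : plane => _) = Num.sqrt \o (fun w : plane => w.1 ^+ 2 + w.2 ^+ 2)).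
  apply: measurableT_comp.
    by apply: continuous_measurable_fun; exact: sqrt_continuous.
  by apply: measurable_funD; apply: measurable_funX;
    [exact: measurable_fst|exact: measurable_snd].
apply/funext => w /=; have /= <- := cabs_sqr (toC w).
by rewrite sqrtr_sqr ger0_norm ?cabs_ge0.
Qed.

Lemma measurable_pdisk : measurable pdisk.
Proof.
rewrite (_ : pdisk = setT `&` (fun w : plane => cabs (toC w)) @^-1` `]-oo, 1[%classic).
  by apply: measurable_cabs => //; exact: measurable_itv.
by rewrite setTI; apply/seteqP; split => w /=; rewrite in_itv.
Qed.

Lemma area_pdisk : (@area R pdisk < +oo)%E.
Proof.
pose I : set (measurableTypeR R) := `[-1, 1]%classic; pose Q : set plane := I `*` I.
have mQ : measurable Q by apply: measurableX; exact: measurable_itv.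
apply: (@le_lt_trans _ _ (@area R Q)).
  apply: le_measure; rewrite ?inE //; first exact: measurable_pdisk.
  move=> -[x y] /ltW h; split; rewrite /I /= in_itv /= -ler_norml.
    exact: le_trans (Re_le_cabs (x +i* y)) h.
  exact: le_trans (Im_le_cabs (x +i* y)) h.
have lQ : leb I = (1 - -1)%:E.
  by rewrite /I lebesgue_measure_itv /= lte_fin; have -> : -1 < 1 :> R by lra.
have -> : area R Q = ((pi^-1)%:E * (leb I * leb I))%E.
  rewrite /area /mscale /=; congr (_ * _)%E.
  by apply: product_measure1E; exact: measurable_itv.
by rewrite lQ -!EFinM ltry.
Qed.

Lemma measurable_sum_ord n (F : nat -> plane -> R) :
  (forall i, measurable_fun pdisk (F i)) -> measurable_fun pdisk (fun w => \sum_(i < n) F i w).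
Proof.
move=> mF; elim: n => [|n IHn]; first by under eq_fun do rewrite big_ord0; exact: measurable_cst.
by under eq_fun do rewrite big_ord_recr /=; exact: measurable_funD.
Qed.

Definition cmeasurable (D : set plane) (f : C -> C) :=
  measurable_fun D (fun w => complex.Re (f (toC w))) /\
  measurable_fun D (fun w => complex.Im (f (toC w))).

Lemma cmeasurable_id D : cmeasurable D id.
Proof.
split; apply: measurable_funTS; [exact: measurable_fst|exact: measurable_snd].
Qed.

Lemma cmeasurable_cst D c : cmeasurable D (fun=> c).
Proof. by split; exact: measurable_cst. Qed.

Lemma cmeasurableD D f g : cmeasurable D f -> cmeasurable D g -> cmeasurable D (fun z => f z + g z).
Proof.
move=> [f1 f2] [g1 g2]; split.
  by under eq_fun do rewrite ReD; exact: measurable_funD.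
by under eq_fun do rewrite ImD; exact: measurable_funD.
Qed.

Lemma cmeasurableM D f g : cmeasurable D f -> cmeasurable D g -> cmeasurable D (fun z => f z * g z).
Proof.
move=> [f1 f2] [g1 g2]; split.
  rewrite (_ : (fun w : plane => _) = (fun w => complex.Re (f (toC w)) * complex.Re (g (toC w)) -
     complex.Im (f (toC w)) * complex.Im (g (toC w)))).
    by apply: measurable_funB; exact: measurable_funM.
  by apply/funext => w; case: (f _); case: (g _).
rewrite (_ : (fun w : plane => _) = (fun w => complex.Re (f (toC w)) * complex.Im (g (toC w)) +
   complex.Im (f (toC w)) * complex.Re (g (toC w)))).
  by apply: measurable_funD; exact: measurable_funM.
by apply/funext => w; case: (f _) => a b; case: (g _) => c d.
Qed.

Lemma cmeasurableB D f g : cmeasurable D f -> cmeasurable D g -> cmeasurable D (fun z => f z - g z).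
Proof.
move=> mf mg; have := cmeasurableD mf (cmeasurableM (cmeasurable_cst D (-1)) mg).
by under eq_fun do rewrite mulN1r.
Qed.

Lemma cmeasurable_poly D (p : {poly C}) : cmeasurable D (horner p).
Proof.
elim/poly_ind: p => [|p c IH].
  by rewrite (_ : horner 0 = fun=> 0); [exact: cmeasurable_cst|apply/funext => z; rewrite horner0].
rewrite (_ : horner _ = fun z => p.[z] * z + c).
  by apply: cmeasurableD (cmeasurable_cst _ _); exact: cmeasurableM IH (cmeasurable_id _).
by apply/funext => z; rewrite hornerD hornerMX hornerC.
Qed.

Lemma cmeasurable_lim D (u : nat -> C -> C) f : (forall n, cmeasurable D (u n)) ->
  (forall w, D w -> forall e : R, 0 < e -> exists N, forall n, (N <= n)%N ->
     cabs (u n (toC w) - f (toC w)) <= e) -> cmeasurable D f.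
Proof.
move=> mu uf.
have cv (g : C -> R) (gle : forall z, `|g z| <= cabs z)
    (gB : forall z w, g (z - w) = g z - g w) (w : plane) :
    D w -> g (u n (toC w)) @[n --> \oo] --> g (f (toC w)).
  move=> wD; apply/cvgrPdist_le => e e0.
  have [N hN] := uf _ wD e e0; exists N => // n /= /hN.
  by rewrite cabs_distC -gB; exact/le_trans/gle.
split.
  apply: measurable_fun_cvg (fun n => (mu n).1) _; apply: cv => [z|z w].
    exact: Re_le_cabs.
  by rewrite ReD ReN.
apply: measurable_fun_cvg (fun n => (mu n).2) _; apply: cv => [z|z w].
  exact: Im_le_cabs.
by rewrite ImD ImN.
Qed.

Lemma measurable_cabs_sqr f : cmeasurable pdisk f ->
  measurable_fun pdisk (fun w => cabs (f (toC w)) ^+ 2).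
Proof.
move=> [f1 f2]; under eq_fun do rewrite cabs_sqr.
by apply: measurable_funD; exact: measurable_funX.
Qed.

Lemma pdisk_rotation (w : C) (z : plane) : cabs w = 1 ->
  pdisk (rotation (complex.Re w) (complex.Im w) z) = pdisk z.
Proof. by move=> w1; rewrite /pdisk /disk /preimage /= toC_rotation cabsM w1 mul1r. Qed.

Lemma cmeasurable_rotation (w : C) f : cabs w = 1 -> cmeasurable pdisk f ->
  cmeasurable pdisk (fun z => f (w * z)).
Proof.
move=> w1 [f1 f2]; have mr := @measurable_rotation R (complex.Re w) (complex.Im w).
have sub : [set rotation (complex.Re w) (complex.Im w) x | x in pdisk] `<=` pdisk.
  by move=> _ [z zD <-]; rewrite pdisk_rotation.
split.
  have := measurable_comp measurable_pdisk sub f1 (measurable_funTS mr).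
  by apply: eq_measurable_fun => z _ /=; rewrite toC_rotation.
have := measurable_comp measurable_pdisk sub f2 (measurable_funTS mr).
by apply: eq_measurable_fun => z _ /=; rewrite toC_rotation.
Qed.

Lemma analytic_cmeasurable f : analytic_on_disk f -> cmeasurable pdisk f.
Proof.
move=> /global_taylor[a ha].
apply: (cmeasurable_lim (fun n => cmeasurable_poly _ (psum a n))) => z zD e e0.
have [N hN] := ha _ (cabs_ge0 (toC z)) zD e e0; exists N => n Nn.
by have := hN n Nn (toC z); rewrite /cball /= subr0; apply.
Qed.

Section Weight.
Variable Lambda : R -> R.
Hypothesis Lambda_gt0 : forall t : R, 0 < t <= 2 -> 0 < Lambda t.
Hypothesis Lambda_noninc :
  forall s t : R, 0 < s -> s <= t -> t <= 2 -> Lambda t <= Lambda s.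

Definition weight (w : plane) : R := expR (- (2 * Lambda (1 - cabs (toC w)))).

Lemma weight_gt0 w : 0 < weight w.
Proof. exact: expR_gt0. Qed.

Lemma pdisk_Lambda w : pdisk w -> 0 < Lambda (1 - cabs (toC w)).
Proof.
move=> wD; have w1 : cabs (toC w) < 1 := wD.
apply: Lambda_gt0; rewrite subr_gt0 w1 /=.
by have := cabs_ge0 (toC w); lra.
Qed.

Lemma weight_le1 w : pdisk w -> weight w <= 1.
Proof. by move=> /pdisk_Lambda h; rewrite /weight -[leRHS]expR0 ler_expR; lra. Qed.

(** Monotone functions are measurable; [Lambda] is monotone only on the interval and
    may be unbounded at $0$, but $e^{-\Lambda}$ extends monotonically to the line. *)
Lemma measurable_Lambda : measurable_fun (`]0, 2]%classic : set R) Lambda.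
Proof.
pose V (t : R) := if t <= 0 then 0 else if t <= 2 then expR (- Lambda t) else 1.
have Vnd : {homo V : s t / s <= t}.
  move=> s t st; rewrite /V; case: (leP s 0) => s0.
    by case: ifP => // _; case: ifP => // _; exact: expR_ge0.
  have t0 : 0 < t by exact: lt_le_trans st.
  rewrite [t <= 0]leNgt t0 /=; case: (leP t 2) => t2.
    by rewrite (le_trans st t2) ler_expR lerN2; exact: Lambda_noninc.
  case: (leP s 2) => // s2; rewrite -[leRHS]expR0 ler_expR oppr_le0 ltW //.
  by apply: Lambda_gt0; rewrite s0.
have mV : measurable_fun setT V by apply: nondecreasing_measurable.
apply: (@eq_measurable_fun _ _ _ _ _ (fun t => - ln (V t))).
  move=> t; rewrite inE /= in_itv /= => /andP[t0 t2].
  by rewrite /V leNgt t0 /= t2 expRK opprK.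
apply: measurable_funTS; apply: measurable_funN; apply: measurableT_comp mV.
exact: measurable_ln.
Qed.

Lemma measurable_weight : measurable_fun pdisk weight.
Proof.
have sub : [set 1 - cabs (toC w) | w in pdisk] `<=` (`]0, 2]%classic : set R).
  move=> _ [w wD <-]; have w1 : cabs (toC w) < 1 := wD.
  by rewrite /= in_itv /= subr_gt0 w1 /=; have := cabs_ge0 (toC w); lra.
have mg : measurable_fun pdisk (fun w => 1 - cabs (toC w)).
  apply: measurable_funTS; apply: measurable_funB; first exact: measurable_cst.
  exact: measurable_cabs.
apply: measurableT_comp; first exact: measurable_expR.
apply: measurable_funN; apply: measurable_funM; first exact: measurable_cst.
by apply: (measurable_comp _ sub measurable_Lambda mg); exact: measurable_itv.
Qed.

Definition mass (phi : plane -> R) : \bar R :=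
  (\int[@area R]_(w in pdisk) (phi w * weight w)%:E)%E.

Lemma measurable_mass (phi : plane -> R) : measurable_fun pdisk phi ->
  measurable_fun pdisk (fun w => (phi w * weight w)%:E).
Proof.
by move=> mp; apply/measurable_EFinP; apply: measurable_funM => //; exact: measurable_weight.
Qed.

Lemma mass_ge0 (phi : plane -> R) : (forall w, pdisk w -> 0 <= phi w) -> (0 <= mass phi)%E.
Proof.
move=> p0; apply: integral_ge0 => w /p0 h.
by rewrite lee_fin mulr_ge0 // ltW // weight_gt0.
Qed.

Lemma le_mass (phi psi : plane -> R) : measurable_fun pdisk phi -> measurable_fun pdisk psi ->
  (forall w, pdisk w -> 0 <= phi w) -> (forall w, pdisk w -> phi w <= psi w) ->
  (mass phi <= mass psi)%E.
Proof.
move=> m1 m2 p0 le; apply: ge0_le_integral => //; first exact: measurable_pdisk.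
- by move=> w /p0 h; rewrite lee_fin mulr_ge0 // ltW // weight_gt0.
- exact: measurable_mass.
- exact: measurable_mass.
- by move=> w /le h; rewrite lee_fin ler_pM2r // weight_gt0.
Qed.

Lemma eq_mass (phi psi : plane -> R) : (forall w, pdisk w -> phi w = psi w) -> mass phi = mass psi.
Proof. by move=> h; apply: eq_integral => w /[!inE] /h ->. Qed.

Lemma massD (phi psi : plane -> R) : measurable_fun pdisk phi -> measurable_fun pdisk psi ->
  (forall w, pdisk w -> 0 <= phi w) -> (forall w, pdisk w -> 0 <= psi w) ->
  mass (fun w => phi w + psi w) = (mass phi + mass psi)%E.
Proof.
move=> m1 m2 p1 p2; rewrite /mass -ge0_integralD //.
- by apply: eq_integral => w _; rewrite mulrDl EFinD.
- exact: measurable_pdisk.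
- by move=> w /p1 h; rewrite lee_fin mulr_ge0 // ltW // weight_gt0.
- exact: measurable_mass.
- by move=> w /p2 h; rewrite lee_fin mulr_ge0 // ltW // weight_gt0.
- exact: measurable_mass.
Qed.

Lemma massZ (k : R) (phi : plane -> R) : 0 <= k -> measurable_fun pdisk phi ->
  (forall w, pdisk w -> 0 <= phi w) ->
  mass (fun w => k * phi w) = (k%:E * mass phi)%E.
Proof.
move=> k0 m1 p1; rewrite /mass -ge0_integralZl_EFin //.
- by apply: eq_integral => w _; rewrite -mulrA EFinM.
- exact: measurable_pdisk.
- by move=> w /p1 h; rewrite lee_fin mulr_ge0 // ltW // weight_gt0.
- exact: measurable_mass.
Qed.

Lemma mass_sum n (phi : nat -> plane -> R) : (forall i, measurable_fun pdisk (phi i)) ->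
  (forall i w, pdisk w -> 0 <= phi i w) ->
  mass (fun w => \sum_(i < n) phi i w) = (\sum_(i < n) mass (phi i))%E.
Proof.
move=> m1 p1; elim: n => [|n IH].
  rewrite big_ord0 /mass (eq_integral (cst 0%E)) ?integral0 // => w _.
  by rewrite big_ord0 mul0r.
have ms := measurable_sum_ord n m1.
have p0 w : pdisk w -> 0 <= \sum_(i < n) phi i w.
  by move=> wD; apply: sumr_ge0 => i _; exact: p1.
rewrite big_ord_recr /= -IH -(massD ms (m1 n) p0 (p1 n)).
by apply: eq_mass => w _; rewrite big_ord_recr.
Qed.

Lemma mass_cst (k : R) : 0 <= k -> (mass (fun=> k) <= k%:E * @area R pdisk)%E.
Proof.
move=> k0; rewrite -integral_cst; last exact: measurable_pdisk.
apply: ge0_le_integral => //; first exact: measurable_pdisk.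
- by move=> w _; rewrite lee_fin mulr_ge0 // ltW // weight_gt0.
- by apply: measurable_mass; exact: measurable_cst.
- by move=> w /weight_le1 h; rewrite lee_fin ler_piMr.
Qed.

Lemma mass_cst_lty (k : R) : 0 <= k -> (mass (fun=> k) < +oo)%E.
Proof.
move=> k0; apply: le_lt_trans (mass_cst k0) _.
by rewrite lte_mul_pinfty // area_pdisk.
Qed.

Lemma mass_fatou (phi : nat -> plane -> R) (psi : plane -> R) (c : \bar R) :
  (forall n, measurable_fun pdisk (phi n)) ->
  (forall n w, pdisk w -> 0 <= phi n w) ->
  (forall w, pdisk w -> phi n w @[n --> \oo] --> psi w) ->
  (forall n, mass (phi n) <= c)%E -> (mass psi <= c)%E.
Proof.
move=> m1 p1 cv le.
have p2 n w : pdisk w -> (0 <= (phi n w * weight w)%:E)%E.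
  by move=> /(p1 n) h; rewrite lee_fin mulr_ge0 // ltW // weight_gt0.
have h := fatou (@area R) measurable_pdisk (fun n => measurable_mass (m1 n)) p2.
rewrite /mass (eq_integral (fun w => limn_einf (fun n => (phi n w * weight w)%:E))); last first.
  move=> w /[!inE] wD; apply/esym.
  suff h1 : (phi n w * weight w)%:E @[n --> \oo] --> (psi w * weight w)%:E.
    by rewrite (cvg_limn_einf_sup h1).1.
  apply: (@cvg_EFin _ _ _ _ (fun n => (phi n w * weight w)%:E)); first exact: nearW.
  by apply: (@cvgMr_tmp R); exact: cv.
apply: le_trans h _; rewrite limn_einf_lim; apply: lime_le.
  exact: is_cvg_einfs.
by apply: nearW => n; apply: le_trans (le n); apply: ereal_inf_lbound; exists n => /=.
Qed.

Lemma mass_rotation (w : C) (phi : plane -> R) : cabs w = 1 -> measurable_fun pdisk phi ->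
  (forall z, pdisk z -> 0 <= phi z) ->
  mass (fun z => phi (rotation (complex.Re w) (complex.Im w) z)) = mass phi.
Proof.
move=> w1 m1 p1; set rot := rotation _ _.
have mr : measurable_fun setT rot by exact: measurable_rotation.
have rD z : pdisk (rot z) = pdisk z by exact: pdisk_rotation.
have sub : [set rot x | x in pdisk] `<=` pdisk by move=> _ [z zD <-]; rewrite rD.
have mrp : measurable_fun pdisk (phi \o rot).
  exact: measurable_comp measurable_pdisk sub m1 (measurable_funTS mr).
have ge0 (psi : plane -> R) : (forall z, pdisk z -> 0 <= psi z) ->
    forall z, pdisk z -> (0 <= (psi z * weight z)%:E)%E.
  by move=> h z /h h'; rewrite lee_fin mulr_ge0 // ltW // weight_gt0.
have p2 z : pdisk z -> 0 <= (phi \o rot) z by move=> zD; apply: p1; rewrite rD.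
rewrite /mass /area !ge0_integral_mscale; first last; try exact: measurable_pdisk.
- exact: ge0 p2.
- exact: measurable_mass mrp.
- exact: ge0 p1.
- exact: measurable_mass m1.
congr (_ * _)%E; rewrite !(integral_mkcond pdisk).
pose F := (fun z => (phi z * weight z)%:E) \_ pdisk.
have mF : measurable_fun setT F.
  by apply/(measurable_restrictT _ measurable_pdisk); exact: measurable_mass.
have F0 z : (0 <= F z)%E by apply: erestrict_ge0; exact: ge0.
have cs : complex.Re w ^+ 2 + complex.Im w ^+ 2 = 1 by rewrite -cabs_sqr w1 expr1n.
rewrite -[RHS](integral_rotation cs mF F0); apply: eq_integral => z _.
rewrite /F /patch -/rot.
have -> : (rot z \in pdisk) = (z \in pdisk).
  by apply/idP/idP; rewrite !inE rD.
by rewrite /weight toC_rotation cabsM w1 mul1r.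
Qed.

Definition sqnorm (f : C -> C) : \bar R := mass (fun w => cabs (f (toC w)) ^+ 2).

Lemma sqnorm_ge0 f : (0 <= sqnorm f)%E.
Proof. by apply: mass_ge0 => w _; exact: sqr_ge0. Qed.

Lemma B2normE f : B2norm Lambda f = sqrte (sqnorm f).
Proof. by []. Qed.

Lemma B2norm_lt f (e : R) : 0 < e -> (sqnorm f < (e ^+ 2)%:E)%E -> (B2norm Lambda f < e%:E)%E.
Proof.
move=> e0; rewrite B2normE; have := sqnorm_ge0 f.
case: (sqnorm f) => [r| |] //=; rewrite !lee_fin !lte_fin => r0 re.
by rewrite -[ltRHS](ger0_norm (ltW e0)) -sqrtr_sqr ltr_sqrt // exprn_gt0.
Qed.

Lemma B2norm_lty f : (B2norm Lambda f < +oo)%E = (sqnorm f < +oo)%E.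
Proof.
rewrite B2normE; have := sqnorm_ge0 f.
by case: (sqnorm f) => [r| |] //=; rewrite !ltry.
Qed.

Lemma eq_sqnorm f g : (forall z, disk z -> f z = g z) -> sqnorm f = sqnorm g.
Proof. by move=> h; apply: eq_mass => w wD; rewrite h. Qed.

Lemma sqnorm_add f g : cmeasurable pdisk f -> cmeasurable pdisk g ->
  (sqnorm (fun z => f z + g z)%R <= 2%:E * sqnorm f + 2%:E * sqnorm g)%E.
Proof.
move=> mf mg; have mf2 := measurable_cabs_sqr mf; have mg2 := measurable_cabs_sqr mg.
have m2 (h : plane -> R) : measurable_fun pdisk h -> measurable_fun pdisk (fun w => 2 * h w).
  by move=> mh; apply: measurable_funM => //; exact: measurable_cst.
have p1 (h : C -> C) (w : plane) : pdisk w -> 0 <= cabs (h (toC w)) ^+ 2.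
  by move=> _; exact: sqr_ge0.
have p2 (h : C -> C) (w : plane) : pdisk w -> 0 <= 2 * cabs (h (toC w)) ^+ 2.
  by move=> _; rewrite mulr_ge0 ?sqr_ge0.
rewrite /sqnorm -(massZ _ mf2 (p1 f)) // -(massZ _ mg2 (p1 g)) //.
rewrite -(massD (m2 _ mf2) (m2 _ mg2) (p2 f) (p2 g)).
apply: le_mass => [|||w _].
- exact: measurable_cabs_sqr (cmeasurableD mf mg).
- by apply: measurable_funD; exact: m2.
- by move=> w _; exact: sqr_ge0.
have h1 := cabs_le_add (f (toC w)) (g (toC w)).
have h0 := cabs_ge0 (f (toC w) + g (toC w)).
rewrite (@le_trans _ _ ((cabs (f (toC w)) + cabs (g (toC w))) ^+ 2)) //.
  by rewrite lerXn2r ?nnegrE ?addr_ge0 ?cabs_ge0.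
by have := sqr_ge0 (cabs (f (toC w)) - cabs (g (toC w))); nra.
Qed.

Lemma sqnorm_bounded f (M : R) : cmeasurable pdisk f -> (forall z, disk z -> cabs (f z) <= M) ->
  (sqnorm f <= (M ^+ 2)%:E * @area R pdisk)%E.
Proof.
move=> mf fM; apply: le_trans (mass_cst (sqr_ge0 M)).
apply: le_mass => [|||w wD]; first exact: measurable_cabs_sqr.
- exact: measurable_cst.
- by move=> w _; exact: sqr_ge0.
have h := fM _ wD; have h0 := cabs_ge0 (f (toC w)).
by rewrite lerXn2r ?nnegrE // (le_trans h0 h).
Qed.

Definition term_mass (c : C) i : \bar R := mass (fun w => (cabs c * cabs (toC w) ^+ i) ^+ 2).

Lemma measurable_term (c : C) i :
  measurable_fun pdisk (fun w : plane => (cabs c * cabs (toC w) ^+ i) ^+ 2).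
Proof.
apply/measurable_funX/measurable_funM; first exact: measurable_cst.
by apply/measurable_funX/measurable_funTS; exact: measurable_cabs.
Qed.

Lemma sqnorm_rotation (w : C) f : cabs w = 1 -> cmeasurable pdisk f ->
  sqnorm (fun z => f (w * z)) = sqnorm f.
Proof.
move=> w1 mf; rewrite /sqnorm -[RHS](mass_rotation w1) //.
- by apply: eq_mass => z _; rewrite toC_rotation.
- exact: measurable_cabs_sqr.
- by move=> z _; exact: sqr_ge0.
Qed.

(** Each rotation preserves the weighted area, hence so does the average over a
    finite group of rotations. *)
Lemma sqnorm_roots n (w : C) f : (0 < n)%N -> cabs w = 1 -> cmeasurable pdisk f ->
  mass (fun z => n%:R^-1 * \sum_(k < n) cabs (f (w ^+ k * toC z)) ^+ 2) = sqnorm f.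
Proof.
move=> n0 w1 mf; pose F (k : nat) (z : plane) := cabs (f (w ^+ k * toC z)) ^+ 2.
have wk k : cabs (w ^+ k) = 1 by rewrite cabsX w1 expr1n.
have mF k : measurable_fun pdisk (F k).
  exact: measurable_cabs_sqr (cmeasurable_rotation (wk k) mf).
have pF k z : pdisk z -> 0 <= F k z by move=> _; exact: sqr_ge0.
have mS := measurable_sum_ord n mF.
have pS z : pdisk z -> 0 <= \sum_(k < n) F k z.
  by move=> zD; apply: sumr_ge0 => k _; exact: pF.
transitivity (mass (fun z => n%:R^-1 * \sum_(k < n) F k z)); first by [].
rewrite (massZ _ mS pS) ?invr_ge0 // (mass_sum n mF pF).
rewrite (eq_bigr (fun=> sqnorm f)) => [|k _]; last by rewrite -(sqnorm_rotation (wk k)).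
have -> : (\sum_(k < n) sqnorm f = n%:R%:E * sqnorm f)%E.
  by rewrite mule_natl sumr_const card_ord.
rewrite muleA -EFinM mulVf ?mul1e //.
by rewrite pnatr_eq0 -lt0n.
Qed.

(** Orthogonality of the monomials, by averaging the discrete Parseval identity. *)
Lemma sqnorm_poly (p : {poly C}) n : (0 < n)%N -> (size p <= n)%N ->
  sqnorm (horner p) = (\sum_(i < n) term_mass p`_i i)%E.
Proof.
move=> n0 sp; have [w pw] := prim_root_exists R n0.
rewrite -(sqnorm_roots n0 (cabs_prim_root pw) (cmeasurable_poly _ p)).
rewrite /term_mass -(mass_sum n (fun i => measurable_term p`_i i)) => [|i z _]; last exact: sqr_ge0.
apply: eq_mass => z _; rewrite (parseval_roots _ pw sp) mulKf //.
by rewrite pnatr_eq0 -lt0n.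
Qed.

(** Bessel's inequality, up to an inessential factor. The Taylor polynomials
    tend to [f] uniformly on each circle, so by the discrete Parseval identity
    the polygonal averages of $2|f|^2 + 2$ eventually exceed every partial sum
    $\sum |a_i|^2 |z|^{2i}$; Fatou's lemma integrates this. *)
Lemma bessel f a M : (forall s, 0 <= s -> s < 1 -> useries a 0 s f) -> cmeasurable pdisk f ->
  (\sum_(i < M) term_mass (a i) i <= 2%:E * sqnorm f + mass (fun=> 2%R))%E.
Proof.
move=> fa mf.
have /choice[w pw] : forall n, exists w : C, n.+1.-primitive_root w.
  by move=> n; exact: prim_root_exists.
pose s (z : plane) := \sum_(i < M) (cabs (a i) * cabs (toC z) ^+ i) ^+ 2.
pose A n (z : plane) := n.+1%:R^-1 * \sum_(k < n.+1) cabs (f (w n ^+ k * toC z)) ^+ 2.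
pose phi n z := Num.min (s z) (2 * A n z + 2).
have ms : measurable_fun pdisk s by exact: measurable_sum_ord (fun i => measurable_term (a i) i).
have s0 z : 0 <= s z by apply: sumr_ge0 => i _; exact: sqr_ge0.
have mA n : measurable_fun pdisk (A n).
  apply: measurable_funM; first exact: measurable_cst.
  apply: (@measurable_sum_ord _ (fun k z => cabs (f (w n ^+ k * toC z)) ^+ 2)) => k.
  have h : cabs (w n ^+ k) = 1 by rewrite cabsX (cabs_prim_root (pw n)) expr1n.
  exact: measurable_cabs_sqr (cmeasurable_rotation h mf).
have A0 n z : 0 <= A n z.
  by rewrite mulr_ge0 ?invr_ge0 ?ler0n //; apply: sumr_ge0 => i _; exact: sqr_ge0.
have m2A n : measurable_fun pdisk (fun z => 2 * A n z).
  by apply: measurable_funM => //; exact: measurable_cst.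
have m2A2 n : measurable_fun pdisk (fun z => 2 * A n z + 2).
  by apply: measurable_funD => //; exact: measurable_cst.
have p2A n z : 0 <= 2 * A n z by rewrite mulr_ge0.
have -> : (\sum_(i < M) term_mass (a i) i)%E = mass s.
  rewrite -(mass_sum M (fun i => measurable_term (a i) i)) // => i z _.
  exact: sqr_ge0.
apply: (mass_fatou (phi := phi)) => [n|n z _|z zD|n].
- exact: measurable_minr.
- by rewrite le_min s0 addr_ge0.
- apply: cvg_near_cst.
  have [N hN] := fa _ (cabs_ge0 (toC z)) zD 1 ltr01.
  exists (maxn N M) => // n /= nNM; apply/min_idPl.
  have nN : (N <= n)%N by apply: leq_trans nNM; rewrite leq_maxl.
  have nM : (M <= n.+1)%N by apply: leqW; apply: leq_trans nNM; rewrite leq_maxr.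
  have sp : (size (psum a n.+1) <= n.+1)%N by exact: size_poly.
  have PE := parseval_roots (toC z) (pw n) sp.
  have n1 : 0 < n.+1%:R :> R by rewrite ltr0n.
  apply: (@le_trans _ _ (\sum_(i < n.+1) (cabs (psum a n.+1)`_i * cabs (toC z) ^+ i) ^+ 2)).
    rewrite /s -(big_mkord predT (fun i => (cabs (a i) * cabs (toC z) ^+ i) ^+ 2)).
    rewrite -(big_mkord predT (fun i => (cabs (psum a n.+1)`_i * cabs (toC z) ^+ i) ^+ 2)).
    rewrite [leRHS](@big_cat_nat _ _ _ M) //= -[leLHS]addr0 lerD //.
      rewrite le_eqVlt; apply/orP; left; apply/eqP.
      apply: eq_big_nat => i /andP[_ iM]; rewrite coef_poly (leq_trans iM nM) //.
    by apply: sumr_ge0 => i _; exact: sqr_ge0.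
  rewrite -(ler_pM2l n1) -PE mulrDr mulrCA /A mulVKf ?lt0r_neq0 //.
  have -> : n.+1%:R * 2 = \sum_(k < n.+1) 2 :> R by rewrite sumr_const card_ord mulr_natl.
  rewrite mulr_sumr -big_split /=; apply: ler_sum => k _.
  have zk : cball 0 (cabs (toC z)) (w n ^+ k * toC z).
    by rewrite /cball /= subr0 cabsM cabsX (cabs_prim_root (pw n)) expr1n mul1r.
  have := hN n.+1 (leqW nN) _ zk; rewrite subr0 => h.
  move: h; set P := (psum a n.+1).[_]; set F := f _ => h.
  have P0 := cabs_ge0 P; have F0 := cabs_ge0 F.
  have PF : cabs P <= cabs F + 1.
    by have := cabs_le_add (P - F) F; rewrite subrK; lra.
  by have := sqr_ge0 (cabs F - 1); nra.
apply: (@le_trans _ _ (mass (fun z => 2 * A n z + 2))).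
  apply: le_mass => [||z _|z _]; [exact: measurable_minr|exact: m2A2| |].
    by rewrite le_min s0 addr_ge0.
  by rewrite ge_min lexx orbT.
have mc : measurable_fun pdisk (fun=> 2 : R) by exact: measurable_cst.
rewrite (massD (m2A n) mc (fun z _ => p2A n z) (fun z _ => ler0n _ 2)).
rewrite (massZ _ (mA n) (fun z _ => A0 n z)) // sqnorm_roots //.
exact: cabs_prim_root (pw n).
Qed.

(** Bessel's inequality makes the masses of the Taylor terms summable; by Fatou's
    lemma the squared distance from $f$ to its Taylor polynomial of order $m$ is at
    most the tail of that series. *)
Lemma poly_dense f (e : R) : B2 Lambda f -> 0 < e ->
  exists p : {poly C}, (sqnorm (fun z => p.[z] - f z)%R <= e%:E)%E.
Proof.
move=> [fan]; rewrite B2norm_lty => flty e0.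
have mf := analytic_cmeasurable fan.
have [a ha] := global_taylor fan.
have tm0 i : (0 <= term_mass (a i) i)%E by apply: mass_ge0 => w _; exact: sqr_ge0.
pose K := (2%:E * sqnorm f + mass (fun=> 2%R))%E.
have K0 : (K < +oo)%E.
  by rewrite lte_add_pinfty // ?mass_cst_lty // lte_mul_pinfty.
have tmlty i : (term_mass (a i) i < +oo)%E.
  apply: le_lt_trans K0; apply: le_trans (bessel i.+1 ha mf).
  by rewrite big_ord_recr /= leeDr // sume_ge0.
pose b i := fine (term_mass (a i) i).
have bE i : term_mass (a i) i = (b i)%:E by rewrite fineK // ge0_fin_numE.
have b0 i : 0 <= b i by rewrite fine_ge0.
pose T n := \sum_(0 <= i < n) b i.
have Tnd : nondecreasing_seq T.
  by move=> m n mn; rewrite /T (@big_cat_nat _ _ _ m 0%N n) //= lerDl sumr_ge0.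
have Tb n : T n <= fine K.
  rewrite -lee_fin fineK; last first.
    rewrite ge0_fin_numE //; apply: le_trans (bessel 0 ha mf); by rewrite big_ord0.
  apply: le_trans (bessel n ha mf).
  rewrite /T -sumEFin big_mkord; apply: lee_sum => i _; by rewrite bE.
have Tcv : cvgn T by apply: nondecreasing_is_cvgn => //; exists (fine K) => _ [n _ <-].
have /cvgrPdist_le/(_ e e0)[m _ hm] := Tcv.
have Tlim n : T n <= limn T by apply: nondecreasing_cvgn_le.
have hmn n : (m <= n)%N -> T n - T m <= e.
  move=> mn; have := hm m (leqnn m); have := Tlim n; have := Tlim m => h1 h2.
  by rewrite /= ger0_norm ?subr_ge0 // => h3; lra.
exists (psum a m).
pose q n := psum a (maxn m n) - psum a m.
apply: (mass_fatou (phi := fun n w => cabs (q n).[toC w] ^+ 2)) => [n|n w _|w wD|n].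
- exact: measurable_cabs_sqr (cmeasurable_poly _ _).
- exact: sqr_ge0.
- apply: (@cvg_comp _ _ _ _ (fun x : R => x ^+ 2)); last first.
    apply: (@exprn_continuous R 2).
  apply/cvgrPdist_le => d d0; have [N hN] := ha _ (cabs_ge0 (toC w)) wD d d0.
  exists N => // n /= Nn.
  have h (x y : C) : `|cabs x - cabs y| <= cabs (x + y).
    rewrite ler_norml; apply/andP; split.
      by have := cabs_le_sub (x + y) x; rewrite addrAC subrr add0r; lra.
    by have := cabs_le_sub (x + y) y; rewrite addrK; lra.
  apply: le_trans (h _ _) _; rewrite /q hornerD hornerN addrC addrA subrK.
  have := hN (maxn m n) (leq_trans Nn (leq_maxr _ _)) (toC w).
  by rewrite subr0; apply; rewrite /cball /= subr0.
rewrite -/(sqnorm (horner (q n))) (@sqnorm_poly _ (maxn m n).+1) //; last first.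
  rewrite (leq_trans (size_polyD _ _)) // geq_max size_polyN.
  by rewrite !(leq_trans (size_poly _ _)) // ?leqW // leq_maxl.
apply: (@le_trans _ _ (T (maxn m n) - T m)%:E); last by rewrite lee_fin hmn // leq_maxl.
rewrite big_ord_recr /= -(big_mkord predT (fun i => term_mass (q n)`_i i)).
have tz i : term_mass 0 i = 0%E.
  rewrite /term_mass /mass (eq_integral (cst 0%E)) ?integral0 // => w _.
  by rewrite cabs0 mul0r expr0n mul0r.
rewrite {2}/q coefB !coef_poly ltnn [(_ < m)%N]ltnNge leq_maxl /= subrr tz adde0.
rewrite (@big_cat_nat _ _ _ m) ?leq_maxl //= big_nat big1 ?add0e => [|i /= im]; last first.
  by rewrite coefB !coef_poly leq_max im subrr tz.
rewrite {1}/T (@big_cat_nat _ _ _ m 0%N (maxn m n)) ?leq_maxl //= addrAC subrr add0r -sumEFin.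
rewrite !big_nat le_eqVlt; apply/orP; left; apply/eqP.
apply: eq_bigr => i /andP[mi iM]; rewrite coefB !coef_poly iM ltnNge mi /= subr0.
exact: bE.
Qed.

End Weight.
End WeightedSpace.

(** * Dyadic condensation of the weight *)

Section Condensation.
Variable R : realType.
Variable Lambda : R -> R.
Hypothesis Lambda_gt0 : forall t : R, 0 < t <= 2 -> 0 < Lambda t.
Hypothesis Lambda_noninc :
  forall s t : R, 0 < s -> s <= t -> t <= 2 -> Lambda t <= Lambda s.

Definition dyad (n : nat) : R := 2^-1 ^+ n.

Lemma dyad_gt0 n : 0 < dyad n.
Proof. by rewrite exprn_gt0 ?invr_gt0. Qed.

Lemma dyadS n : dyad n.+1 = dyad n / 2.
Proof. by rewrite /dyad exprSr. Qed.

Lemma dyad_le1 n : dyad n <= 1.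
Proof. by rewrite exprn_ile1 ?invr_ge0 ?invf_le1 ?ler1n. Qed.

Lemma dyad_le m n : (m <= n)%N -> dyad n <= dyad m.
Proof. by move=> mn; rewrite ler_wiXn2l ?invr_ge0 ?invf_le1 ?ler1n. Qed.

Lemma Lambda_dyad_gt0 n : 0 < Lambda (dyad n).
Proof. by apply: Lambda_gt0; rewrite dyad_gt0 (le_trans (dyad_le1 n)) ?ler1n. Qed.

Definition jump n : R := Lambda (dyad n.+1) - Lambda (dyad n).

Lemma jump_ge0 n : 0 <= jump n.
Proof.
by rewrite subr_ge0 Lambda_noninc ?dyad_gt0 ?dyad_le // (le_trans (dyad_le1 n)) ?ler1n.
Qed.

(** The increments of [Lambda] at the dyadic points that lie beyond [t] telescope
    to at most [Lambda t]. *)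
Lemma sum_jump_le n (t : R) : 0 < t -> t <= 1 ->
  \sum_(i < n) jump i * (t < dyad i.+1)%R%:R <= Lambda t.
Proof.
move=> t0 t1; have t2 : t <= 2 by rewrite (le_trans t1) ?ler1n.
elim: n => [|n IH]; first by rewrite big_ord0 ltW // Lambda_gt0 // t0.
case: (ltP t (dyad n.+1)) => tn; last first.
  by rewrite big_ord_recr /= ltNge tn mulr0 addr0.
rewrite (eq_bigr (fun i : 'I_n.+1 => jump i)) => [|i _]; last first.
  by rewrite (lt_le_trans tn) ?mulr1 // dyad_le.
rewrite -(big_mkord predT jump) telescope_sumr //.
rewrite (@le_trans _ _ (Lambda (dyad n.+1))) //.
  by rewrite gerBl ltW ?Lambda_dyad_gt0.
by apply: Lambda_noninc => //; [exact: ltW|rewrite (le_trans (dyad_le1 _)) ?ler1n].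
Qed.

Lemma integral_Lambda_dyad n :
  (\int[@lebesgue_measure R]_(t in `](dyad n), 2%R]) (Lambda t)%:E <=
   (\sum_(i < n.+1) Lambda (dyad i) * dyad i)%:E)%E.
Proof.
have piece (a b : R) : 0 < a -> a <= b -> b <= 2 ->
    (\int[@lebesgue_measure R]_(t in `]a, b]) (Lambda t)%:E <= (Lambda a * (b - a))%:E)%E.
  move=> a0 ab b2.
  have sub : `]a, b]%classic `<=` (`]0, 2]%classic : set R).
    by move=> t /=; rewrite !in_itv /= => /andP[h1 h2]; rewrite (lt_trans a0 h1) (le_trans h2).
  apply: (@le_trans _ _ (\int[@lebesgue_measure R]_(t in `]a, b]) (cst (Lambda a)%:E t))%E).
    apply: ge0_le_integral => //.
    - by move=> t /sub; rewrite /= in_itv /= => /Lambda_gt0/ltW; rewrite lee_fin.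
    - apply/measurable_EFinP; exact: measurable_funS sub (measurable_Lambda Lambda_gt0 Lambda_noninc).
    - move=> t; rewrite /= in_itv /= => /andP[h1 h2].
      by rewrite lee_fin Lambda_noninc // ?(ltW h1) // (le_trans h2).
  have lm : (@lebesgue_measure R (`]a, b]%classic : set R) <= (b - a)%:E)%E.
    rewrite lebesgue_measure_itv /= lte_fin.
    by case: ifP => _; rewrite ?EFinB // lee_fin subr_ge0.
  rewrite integral_cst // EFinM; apply: lee_wpmul2l lm.
  by rewrite lee_fin ltW // Lambda_gt0 // a0 (le_trans ab).
elim: n => [|n IH].
  apply: le_trans (piece _ _ (dyad_gt0 0) _ (lexx _)) _; rewrite /dyad expr0 ?ler1n //.
  by rewrite big_ord1 expr0 lee_fin; lra.
have le1 : dyad n.+1 <= dyad n by exact: dyad_le.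
have le2 : dyad n <= 2 by rewrite (le_trans (dyad_le1 n)) ?ler1n.
have d0 := dyad_gt0 n.+1.
have -> : `](dyad n.+1), 2%R]%classic = `](dyad n.+1), (dyad n)] `|` `](dyad n), 2] :> set R.
  apply/seteqP; split => t /=; rewrite !in_itv /=.
    by move=> /andP[h1 h2]; case: (leP t (dyad n)) => h; [left; rewrite h1|right].
  by case=> /andP[h1 h2]; rewrite ?h1 ?h2 ?(le_trans h2) // (le_lt_trans le1).
have sub1 : `](dyad n.+1), (dyad n)] `|` `](dyad n), 2] `<=` (`]0, 2]%classic : set R).
  move=> t /= []; rewrite !in_itv /= => /andP[h1 h2].
    by rewrite (lt_trans d0) // (le_trans h2).
  by rewrite (lt_trans (dyad_gt0 n)).
rewrite ge0_integral_setU //=; last 3 first.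
- apply/measurable_EFinP; exact: measurable_funS sub1 (measurable_Lambda Lambda_gt0 Lambda_noninc).
- by move=> t /sub1; rewrite /= in_itv /= => /Lambda_gt0/ltW; rewrite lee_fin.
- apply/disj_setPS => t /= []; rewrite !in_itv /= => /andP[_ h1] /andP[h2 _].
  by move: (le_lt_trans h1 h2); rewrite ltxx.
rewrite big_ord_recr /= EFinD addeC leeD //.
apply: le_trans (piece _ _ d0 le1 le2) _.
by rewrite lee_fin ler_wpM2l ?(ltW (Lambda_dyad_gt0 _)) // dyadS; lra.
Qed.

Hypothesis Lambda_int :
  (\int[@lebesgue_measure R]_(t in `]0%R, 2%R]) (Lambda t)%:E = +oo)%E.

(** Cauchy condensation. *)
Lemma dyad_sum_unbounded (K : R) : exists n, K < \sum_(i < n.+1) Lambda (dyad i) * dyad i.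
Proof.
apply: contrapT => /forallNP h.
have hK n : (\int[@lebesgue_measure R]_(t in `](dyad n), 2%R]) (Lambda t)%:E <= K%:E)%E.
  apply: le_trans (integral_Lambda_dyad n) _; rewrite lee_fin leNgt.
  by apply/negP/h.
pose F n : set (measurableTypeR R) := `](dyad n), 2]%classic.
have FU : \bigcup_n F n = `]0, 2]%classic.
  apply/seteqP; split => t /=.
    by move=> [n _]; rewrite /F /= !in_itv /= => /andP[h1 ->]; rewrite (lt_trans (dyad_gt0 n)).
  rewrite in_itv /= => /andP[t0 t2].
  have [|||N hN] := @geo_small R 2^-1 (t / 2); [lra|lra|lra|].
  exists N => //; rewrite /F /= in_itv /= t2 andbT (le_lt_trans (hN N (leqnn _))) //.
  by rewrite gtr_pMr // invf_lt1 ?ltr1n.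
have nd : nondecreasing_seq F.
  move=> m n mn; apply/subsetPset => t; rewrite /F /= !in_itv /= => /andP[h1 ->].
  by rewrite (le_lt_trans (dyad_le mn)).
have sub n : F n `<=` (`]0, 2]%classic : set R).
  by rewrite -FU; exact: bigcup_sup.
have cv := @ge0_nondecreasing_set_cvg_integral _ _ R F (fun t : measurableTypeR R => (Lambda t)%:E)
  (@lebesgue_measure R) nd _ _ _.
have {}cv : (\int[@lebesgue_measure R]_(t in F n) (Lambda t)%:E)%E @[n --> \oo] --> +oo%E.
  rewrite -Lambda_int -FU; apply: cv => [n|n|n t /sub].
  - exact: measurable_itv.
  - apply/measurable_EFinP; exact: measurable_funS (sub n) (measurable_Lambda Lambda_gt0 Lambda_noninc).
  - by rewrite /= in_itv /= => /Lambda_gt0/ltW; rewrite lee_fin.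
suff : (+oo <= K%:E :> \bar R)%E by rewrite leye_eq.
have /cvg_lim <- // := cv.
by apply: lime_le; [apply/cvg_ex; eexists; exact: cv|exact: nearW].
Qed.

(** Summation by parts: up to boundary terms the sum is half of the condensed
    one. *)
Lemma jump_sum_unbounded (K : R) : exists n, K < \sum_(i < n) jump i * dyad i.+1.
Proof.
pose u i := Lambda (dyad i) * dyad i.
have u0 i : 0 <= u i by rewrite mulr_ge0 // ltW ?Lambda_dyad_gt0 ?dyad_gt0.
have [n hn] := dyad_sum_unbounded (K * 2 + u 0%N * 2).
exists n.
have -> : \sum_(i < n) jump i * dyad i.+1 =
    (\sum_(i < n.+1) u i) / 2 - u 0%N + u n / 2.
  clear hn; elim: n => [|n IH].
    by rewrite big_ord0 big_ord1; field.
  by rewrite big_ord_recr /= IH [in RHS]big_ord_recr /= /jump /u dyadS; field.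
by have := u0 n; move: hn; rewrite -/u; lra.
Qed.

End Condensation.

(** * Integrals over the circle and resolvents *)

Section CircleIntegrals.
Variable R : realType.
Local Notation C := R[i].
Local Notation plane := (measurableTypeR R * measurableTypeR R)%type.
Variable nu : {finite_measure set plane -> \bar R}.
Implicit Types (k l : C -> C) (z zeta : C).

Definition pcircle : set plane := @toC R @^-1` @circle R.

Lemma measurable_pcircle : measurable pcircle.
Proof.
rewrite (_ : pcircle = setT `&` (fun w : plane => cabs (toC w)) @^-1` [set 1]).
  by apply: measurable_cabs => //; exact: measurable_set1.
by rewrite setTI.
Qed.

Definition circle_mass : R := fine (nu pcircle).

Lemma circle_mass_ge0 : 0 <= circle_mass.
Proof. exact: fine_ge0. Qed.

Lemma nu_pcircle : nu pcircle = circle_mass%:E.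
Proof. by rewrite /circle_mass fineK // fin_num_measure //; exact: measurable_pcircle. Qed.

Lemma bounded_integrable (g : plane -> R) (M : R) : measurable_fun pcircle g ->
  (forall w, pcircle w -> `|g w| <= M) -> nu.-integrable pcircle (EFin \o g).
Proof.
move=> mg gM; apply: measurable_bounded_integrable => //.
- exact: measurable_pcircle.
- by have : (nu pcircle < +oo)%E by rewrite nu_pcircle ltry.
- exists M; split; first exact: num_real.
  by move=> N MN w wC; exact: le_trans (gM w wC) (ltW MN).
Qed.

Lemma Rintegral_le (g : plane -> R) (M : R) : measurable_fun pcircle g ->
  (exists N : R, forall w, pcircle w -> `|g w| <= N) ->
  (forall w, pcircle w -> g w <= M) -> Rintegral nu pcircle g <= M * circle_mass.
Proof.
move=> mg [N gN] gM; have mC := measurable_pcircle.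
rewrite -[M * circle_mass](_ : Rintegral nu pcircle (cst M) = _); last first.
  by rewrite Rintegral_cst.
apply: le_Rintegral => //; first exact: bounded_integrable gN.
by apply: (bounded_integrable (M := `|M|)); [exact: measurable_cst|move=> w _ /=].
Qed.

Lemma Rintegral_abs_le (g : plane -> R) (M : R) : measurable_fun pcircle g ->
  (forall w, pcircle w -> `|g w| <= M) -> `|Rintegral nu pcircle g| <= M * circle_mass.
Proof.
move=> mg gM; have ig := bounded_integrable mg gM; have mC := measurable_pcircle.
rewrite (le_trans (le_normr_Rintegral mC ig)) //.
apply: Rintegral_le => //; first exact: measurableT_comp.
by exists M => w /gM; rewrite normr_id.
Qed.

(** Measurability and boundedness on the circle make the real and imaginary parts
    integrable for the finite measure [nu], and are stable under the algebraic
    operations and uniform limits that produce the kernels. *)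
Definition bmeas k := cmeasurable pcircle k /\
  exists M : R, forall zeta, circle zeta -> cabs (k zeta) <= M.

Definition cint k : C := cintegral nu (@circle R) k.

Lemma bmeas_Re k : bmeas k -> nu.-integrable pcircle (EFin \o (fun w => complex.Re (k (toC w)))).
Proof.
move=> [[m1 _] [M kM]]; apply: (bounded_integrable m1) => w wC.
exact: le_trans (Re_le_cabs _) (kM _ wC).
Qed.

Lemma bmeas_Im k : bmeas k -> nu.-integrable pcircle (EFin \o (fun w => complex.Im (k (toC w)))).
Proof.
move=> [[_ m1] [M kM]]; apply: (bounded_integrable m1) => w wC.
exact: le_trans (Im_le_cabs _) (kM _ wC).
Qed.

Lemma bmeas_cst c : bmeas (fun=> c).
Proof. by split; [exact: cmeasurable_cst|exists (cabs c)]. Qed.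

Lemma bmeasD k l : bmeas k -> bmeas l -> bmeas (fun zeta => k zeta + l zeta).
Proof.
move=> [mk [M kM]] [ml [N lN]]; split; first exact: cmeasurableD.
by exists (M + N) => zeta hz; rewrite (le_trans (cabs_le_add _ _)) // lerD ?kM ?lN.
Qed.

Lemma bmeasM k l : bmeas k -> bmeas l -> bmeas (fun zeta => k zeta * l zeta).
Proof.
move=> [mk [M kM]] [ml [N lN]]; split; first exact: cmeasurableM.
by exists (M * N) => zeta hz; rewrite cabsM ler_pM ?cabs_ge0 ?kM ?lN.
Qed.

Lemma circle_neq0 zeta : circle zeta -> zeta != 0.
Proof. by apply: contraPneq => ->; rewrite /circle /= cabs0 => /eqP; rewrite eq_sym oner_eq0. Qed.

(** On the circle the inverse is the conjugate. *)
Lemma bmeas_inv : bmeas (fun zeta => zeta^-1).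
Proof.
split; last by exists 1 => zeta; rewrite /circle /= cabsV => ->; rewrite invr1.
have sq (w : plane) : pcircle w -> w.1 ^+ 2 + w.2 ^+ 2 = 1.
  by move=> wC; have /= <- := cabs_sqr (toC w); rewrite (wC : cabs (toC w) = 1) expr1n.
split.
  apply: (@eq_measurable_fun _ _ _ _ _ (fun w : plane => w.1)).
    by move=> w /[!inE] /sq h; rewrite /= h divr1.
  by apply: measurable_funTS; exact: measurable_fst.
apply: (@eq_measurable_fun _ _ _ _ _ (fun w : plane => - w.2)).
  by move=> w /[!inE] /sq h; rewrite /= h divr1.
by apply: measurable_funTS; apply: measurable_funN; exact: measurable_snd.
Qed.

Lemma bmeas_exp k n : bmeas k -> bmeas (fun zeta => k zeta ^+ n).
Proof.
move=> hk; elim: n => [|n IH].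
  by rewrite (_ : (fun _ => _) = fun=> 1); [exact: bmeas_cst|apply/funext => z; rewrite expr0].
rewrite (_ : (fun _ => _) = fun zeta => k zeta * k zeta ^+ n); first exact: bmeasM.
by apply/funext => z; rewrite exprS.
Qed.

Lemma bmeas_sum n (k : nat -> C -> C) : (forall i, bmeas (k i)) ->
  bmeas (fun zeta => \sum_(i < n) k i zeta).
Proof.
move=> hk; elim: n => [|n IH].
  by rewrite (_ : (fun _ => _) = fun=> 0); [exact: bmeas_cst|apply/funext => z; rewrite big_ord0].
rewrite (_ : (fun _ => _) = fun zeta => \sum_(i < n) k i zeta + k n zeta); first exact: bmeasD.
by apply/funext => z; rewrite big_ord_recr.
Qed.

Lemma bmeas_lim (u : nat -> C -> C) k : (forall n, bmeas (u n)) ->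
  (forall e : R, 0 < e -> exists N, forall n, (N <= n)%N -> forall zeta, circle zeta ->
     cabs (u n zeta - k zeta) <= e) -> bmeas k.
Proof.
move=> hu uk; split.
  apply: (cmeasurable_lim (fun n => (hu n).1)) => w wC e /uk[N hN].
  by exists N => n Nn; exact: hN.
have [N /(_ N (leqnn _)) hN] := uk 1 ltr01; have [_ [M hM]] := hu N.
exists (M + 1) => zeta hz; have := cabs_le_sub (u N zeta) (u N zeta - k zeta).
by rewrite subKr => /le_trans; apply; rewrite lerD ?hM ?hN.
Qed.

Lemma eq_cint k l : (forall zeta, circle zeta -> k zeta = l zeta) -> cint k = cint l.
Proof.
move=> kl; rewrite /cint /cintegral; congr (_ +i* _);
  by apply: eq_Rintegral => w; rewrite inE => wC; rewrite kl.
Qed.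

Lemma cintD k l : bmeas k -> bmeas l -> cint (fun zeta => k zeta + l zeta) = cint k + cint l.
Proof.
move=> hk hl; rewrite /cint /cintegral; have mC := measurable_pcircle.
apply/eqP; rewrite eq_complex /=; apply/andP; split; apply/eqP.
  rewrite -RintegralD //; [|exact: bmeas_Re|exact: bmeas_Re].
  by apply: eq_Rintegral => w _; rewrite ReD.
rewrite -RintegralD //; [|exact: bmeas_Im|exact: bmeas_Im].
by apply: eq_Rintegral => w _; rewrite ImD.
Qed.

Lemma cintZ (c : C) k : bmeas k -> cint (fun zeta => c * k zeta) = c * cint k.
Proof.
move=> hk; rewrite /cint /cintegral; have mC := measurable_pcircle.
have iR := bmeas_Re hk; have iI := bmeas_Im hk.
have iZ (a : R) g : nu.-integrable pcircle (EFin \o g) ->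
    nu.-integrable pcircle (EFin \o (fun w => a * g w)).
  by move=> ig; have := integrableZl mC a ig; apply: eq_integrable => // w _; rewrite /= EFinM.
case: c => a b; apply/eqP; rewrite eq_complex /=; apply/andP; split; apply/eqP.
  rewrite -!RintegralZl // -RintegralB //; [|exact: iZ|exact: iZ].
  by apply: eq_Rintegral => w _; case: (k _).
rewrite -!RintegralZl // -RintegralD //; [|exact: iZ|exact: iZ].
by apply: eq_Rintegral => w _; case: (k _) => x y /=.
Qed.

Lemma cint_sum n (k : nat -> C -> C) : (forall i, bmeas (k i)) ->
  cint (fun zeta => \sum_(i < n) k i zeta) = \sum_(i < n) cint (k i).
Proof.
move=> hk; elim: n => [|n IH].
  rewrite big_ord0 (@eq_cint _ (fun zeta => 0 * (0 : C))) => [|z _]; last by rewrite big_ord0 mul0r.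
  by rewrite (cintZ 0 (bmeas_cst 0)) mul0r.
rewrite big_ord_recr /= -IH -cintD //; last exact: bmeas_sum.
by apply: eq_cint => z _; rewrite big_ord_recr.
Qed.

(** The factor $2$ comes from bounding the two real parts separately. *)
Lemma cint_bound k (M : R) : bmeas k -> (forall zeta, circle zeta -> cabs (k zeta) <= M) ->
  cabs (cint k) <= 2 * (M * circle_mass).
Proof.
move=> [[m1 m2] _] kM; rewrite (le_trans (cabs_le_Re_Im _)) // mulr_natl mulr2n lerD //=.
  by apply: Rintegral_abs_le => // w /kM; exact/le_trans/Re_le_cabs.
by apply: Rintegral_abs_le => // w /kM; exact/le_trans/Im_le_cabs.
Qed.

Lemma Re_cint_le k (M : R) : bmeas k ->
  (forall zeta, circle zeta -> complex.Re (k zeta) <= M) ->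
  complex.Re (cint k) <= M * circle_mass.
Proof.
move=> [[m1 _] [N kN]] kM; apply: Rintegral_le => [//||w /kM //].
by exists N => w /kN; exact/le_trans/Re_le_cabs.
Qed.

(** For $b > 1$ this kernel is bounded up to $|z| = 1$; for $b = 1$ it is the
    singular part of the kernel that defines the inner function. *)
Definition resolvent (b : R) z zeta : C := (b%:C - z / zeta)^-1.

Definition geo_part (b : R) z n zeta : C :=
  \sum_(i < n) b%:C ^- i.+1 * z ^+ i * zeta^-1 ^+ i.

Lemma cabs_circle_div z zeta : circle zeta -> cabs (z / zeta) = cabs z.
Proof. by rewrite /circle /= cabsM cabsV => ->; rewrite invr1 mulr1. Qed.

Lemma sub_le_cabs (b : R) z : b - cabs z <= cabs (b%:C - z).
Proof.
have := Re_le_cabs (b%:C - z); have := ler_norm (complex.Re (b%:C - z)).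
have := ler_norm (complex.Re z); have := Re_le_cabs z.
by rewrite ReD ReN /=; lra.
Qed.

Lemma geo_partP (b r : R) z n zeta : 0 <= r -> r < b -> cabs z <= r -> circle zeta ->
  cabs (geo_part b z n zeta - resolvent b z zeta) <= (r / b) ^+ n / (b - r).
Proof.
move=> r0 rb zr hz; have b0 : 0 < b by exact: le_lt_trans rb.
have bC : b%:C != 0 :> C by rewrite -(rmorph0 (@real_complex R)) (inj_eq (@complexI R)) lt0r_neq0.
rewrite /geo_part /resolvent; set w := z / zeta.
have wr : cabs w <= r by rewrite cabs_circle_div.
have d0 : b - r <= cabs (b%:C - w) by rewrite (le_trans _ (sub_le_cabs _ _)) // lerD2l lerN2.
have dC : b%:C - w != 0.
  apply: contraTneq d0 => ->; rewrite cabs0 -ltNge subr_gt0 //.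
have -> : \sum_(i < n) b%:C ^- i.+1 * z ^+ i * zeta^-1 ^+ i =
    b%:C^-1 * \sum_(i < n) (w / b%:C) ^+ i.
  rewrite mulr_sumr; apply: eq_bigr => i _.
  rewrite /w !exprMn !exprVn exprS invfM -!mulrA; congr (_ * _).
  by rewrite mulrC -mulrA.
have E : b%:C^-1 * (\sum_(i < n) (w / b%:C) ^+ i) - (b%:C - w)^-1 =
    - ((w / b%:C) ^+ n / (b%:C - w)).
  have := subrX1 (w / b%:C) n; set S := \sum_(i < n) _; set X := _ ^+ n => XE.
  have -> : X = 1 + (w / b%:C - 1) * S by rewrite -XE addrC subrK.
  by field; rewrite dC bC.
rewrite E cabsN cabsM cabsV cabsX cabsM cabsV cabs_real gtr0_norm //.
rewrite ler_pM ?exprn_ge0 ?invr_ge0 ?divr_ge0 ?cabs_ge0 ?(ltW b0) //.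
  rewrite lerXn2r ?nnegrE ?divr_ge0 ?cabs_ge0 ?(ltW b0) //.
  by rewrite ler_wpM2r // invr_ge0 ltW.
by rewrite lef_pV2 ?posrE ?subr_gt0 // (lt_le_trans _ d0) // subr_gt0.
Qed.

Lemma geo_rate (b r e : R) : 0 <= r -> r < b -> 0 < e ->
  exists N, forall n, (N <= n)%N -> (r / b) ^+ n / (b - r) <= e.
Proof.
move=> r0 rb e0; have b0 : 0 < b by exact: le_lt_trans rb.
have q0 : 0 <= r / b by rewrite divr_ge0 // ltW.
have q1 : r / b < 1 by rewrite ltr_pdivrMr // mul1r.
have br : 0 < b - r by rewrite subr_gt0.
have [N hN] := geo_small q0 q1 (mulr_gt0 e0 br).
by exists N => n /hN; rewrite ler_pdivrMr.
Qed.

Lemma bmeas_geo_term (c : C) i : bmeas (fun zeta => c * zeta^-1 ^+ i).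
Proof. by apply: bmeasM; [exact: bmeas_cst|apply: bmeas_exp; exact: bmeas_inv]. Qed.

Lemma bmeas_geo_part (b : R) z n : bmeas (geo_part b z n).
Proof.
exact: (@bmeas_sum n (fun i zeta => b%:C ^- i.+1 * z ^+ i * zeta^-1 ^+ i)
  (fun i => bmeas_geo_term _ i)).
Qed.

Lemma bmeas_resolvent (b : R) z : cabs z < b -> bmeas (resolvent b z).
Proof.
move=> zb; apply: (@bmeas_lim (geo_part b z)) => [n|e e0].
  exact: bmeas_geo_part.
have [N hN] := geo_rate (cabs_ge0 z) zb e0; exists N => n /hN h zeta hz.
by rewrite (le_trans _ h) // geo_partP ?cabs_ge0.
Qed.

(** Expanding the resolvent in a geometric series makes its integral a uniform
    limit of polynomials on every disk of radius less than [b]. *)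
Lemma polylim_resolvent (b r : R) : 0 <= r -> r < b ->
  polylim (cball 0 r) (fun z => cint (resolvent b z)).
Proof.
move=> r0 rb e e0.
have t1 : 0 < 2 * (circle_mass + 1) by rewrite mulr_gt0 // ltr_wpDl ?circle_mass_ge0.
have [N hN] := geo_rate r0 rb (divr_gt0 e0 t1).
exists (psum (fun i => b%:C ^- i.+1 * cint (fun zeta => zeta^-1 ^+ i)) N) => z.
rewrite /cball /= subr0 => zr.
have ng := bmeas_geo_part b z N.
have nr := bmeas_resolvent (le_lt_trans zr rb).
have -> : (psum (fun i => b%:C ^- i.+1 * cint (fun zeta => zeta^-1 ^+ i)) N).[z] =
    cint (geo_part b z N).
  rewrite psumE (@cint_sum N (fun i zeta => b%:C ^- i.+1 * z ^+ i * zeta^-1 ^+ i)); last first.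
    by move=> i; exact: bmeas_geo_term.
  apply: eq_bigr => i _; rewrite cintZ; last by apply: bmeas_exp; exact: bmeas_inv.
  by rewrite mulrAC.
have -> : cint (geo_part b z N) - cint (resolvent b z) =
    cint (fun zeta => geo_part b z N zeta + -1 * resolvent b z zeta).
  rewrite cintD ?cintZ ?mulN1r //; apply: bmeasM => //; exact: bmeas_cst.
have h := hN N (leqnn _).
rewrite (le_trans (cint_bound (M := e / (2 * (circle_mass + 1))) _ _)) //.
- by apply: bmeasD => //; apply: bmeasM => //; exact: bmeas_cst.
- by move=> zeta hz; rewrite mulN1r (le_trans _ h) // geo_partP.
rewrite mulrCA mulrAC -mulrA ler_piMr ?(ltW e0) // ler_pdivrMr // mul1r.
by rewrite ler_pM2l // lerDl.
Qed.

End CircleIntegrals.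

(** * The shifted kernels *)

Section Kernels.
Variable R : realType.
Local Notation C := R[i].
Local Notation plane := (measurableTypeR R * measurableTypeR R)%type.
Implicit Types (x z w zeta : C) (e d t : R).

Lemma Re_inv x : complex.Re x^-1 = complex.Re x / cabs x ^+ 2.
Proof. by rewrite cabs_sqr; case: x. Qed.

Lemma ReZ (a : R) x : complex.Re (a%:C * x) = a * complex.Re x.
Proof. by case: x => u v /=; rewrite mul0r subr0. Qed.

Lemma Re_gt0_neq0 x : 0 < complex.Re x -> x != 0.
Proof. by apply: contraTneq => ->; rewrite ltxx. Qed.

(** The heart of the matter. Since $\Re\frac1{x+d} - \frac{d}{|x+d|^2} \le \Re\frac1x$,
    giving up the factor $1-e$ makes the difference negative as soon as
    $\Re x \ge d/e$. *)
Lemma Re_inv_shift_le x e d t : 0 < e -> 0 < d -> 0 < t -> t <= complex.Re x ->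
  complex.Re ((1 - e)%:C * (d%:C + x)^-1 - x^-1) <= d^-1 * (t < d / e)%R%:R.
Proof.
move=> e0 d0 t0; case: x => a b /= ta; have a0 : 0 < a by exact: lt_le_trans ta.
set Q := (d + a) ^+ 2 + (0 + b) ^+ 2.
have b2 : 0 <= b ^+ 2 by exact: sqr_ge0.
have P0 : 0 < a ^+ 2 + b ^+ 2 by nra.
have Q0 : 0 < Q by rewrite /Q add0r; nra.
have PQ : a ^+ 2 + b ^+ 2 <= Q by rewrite /Q add0r; nra.
have h1 : a / Q <= a / (a ^+ 2 + b ^+ 2) by rewrite ler_pM2l // lef_pV2.
have h2 : (1 - e) * ((d + a) / Q) - a / Q = (d - e * (d + a)) / Q by ring.
apply: (@le_trans _ _ ((d - e * (d + a)) / Q)).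
  by rewrite -h2; move: h1; lra.
case: (ltP t (d / e)) => h; rewrite ?mulr1 ?mulr0.
  have dQ : d ^+ 2 <= Q by rewrite /Q add0r; nra.
  rewrite ler_pdivrMr // (@le_trans _ _ (d^-1 * d ^+ 2)) //.
    by rewrite expr2 mulKf ?lt0r_neq0 // gerBl; nra.
  by rewrite ler_pM2l // invr_gt0.
rewrite pmulr_lle0 ?invr_gt0 // subr_le0.
have : d <= t * e by rewrite -ler_pdivrMr.
nra.
Qed.

Lemma cabs_inv_shift_le x e d t : 0 <= e -> e <= 1 -> 0 <= d -> 0 < t ->
  t <= complex.Re x -> cabs x <= 2 ->
  cabs ((1 - e)%:C * (d%:C + x)^-1 - x^-1) <= (2 * e + d) / t ^+ 2.
Proof.
move=> e0 e1 d0 t0 tx x2.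
have xN : x != 0 by apply: Re_gt0_neq0; exact: lt_le_trans tx.
have dx : t <= complex.Re (d%:C + x) by rewrite ReD /= (le_trans tx) // lerDr.
have dxN : d%:C + x != 0 by apply: Re_gt0_neq0; exact: lt_le_trans dx.
have -> : (1 - e)%:C * (d%:C + x)^-1 - x^-1 = - ((e%:C * x + d%:C) * ((d%:C + x)^-1 * x^-1)).
  by rewrite rmorphB /=; field; rewrite dxN xN.
have tc y : t <= complex.Re y -> cabs y^-1 <= t^-1.
  move=> ty; have h : t <= cabs y.
    by rewrite (le_trans ty) // (le_trans (ler_norm _)) // Re_le_cabs.
  by rewrite cabsV lef_pV2 ?posrE // (lt_le_trans t0).
rewrite cabsN cabsM ler_pM ?cabs_ge0 //.
  rewrite (le_trans (cabs_le_add _ _)) // cabsM !cabs_real !ger0_norm // lerD2r.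
  by rewrite mulrC ler_wpM2r.
by rewrite cabsM -exprVn expr2 ler_pM ?cabs_ge0 ?tc.
Qed.

(** The map $w \mapsto 1/(1-w)$ sends the disk into the half-plane
    $\Re > 1/2$. *)
Lemma Re_inv_ge_half w : cabs w < 1 -> 1 <= complex.Re (2%:C * (1%:C - w)^-1).
Proof.
move=> w1; rewrite ReZ Re_inv.
have w2 : cabs w ^+ 2 < 1 by rewrite expr_lt1 ?cabs_ge0.
have -> : cabs (1%:C - w) ^+ 2 = 1 - 2 * complex.Re w + cabs w ^+ 2.
  by rewrite !cabs_sqr; case: w {w1 w2} => a b /=; ring.
have wr : complex.Re w < 1.
  by rewrite (le_lt_trans _ w1) // (le_trans (ler_norm _)) // Re_le_cabs.
have p0 : 0 < 1 - 2 * complex.Re w + cabs w ^+ 2.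
  have := sqr_ge0 (1 - complex.Re w); have := cabs_sqr w.
  by have := sqr_ge0 (complex.Im w); nra.
by rewrite mulrA ler_pdivlMr // ReD ReN /=; lra.
Qed.

Lemma cayley z zeta : circle zeta -> disk z ->
  (zeta + z) / (zeta - z) = 2%:C * resolvent 1 z zeta + (-1)%:C.
Proof.
move=> hz zD; have z0 := circle_neq0 hz.
have dN : zeta - z != 0.
  rewrite subr_eq0; apply: contraTneq zD => <-; apply/negP.
  by rewrite /disk /= (hz : cabs zeta = 1) ltxx.
have wN : 1 - z / zeta != 0.
  have -> : 1 - z / zeta = (zeta - z) / zeta by field.
  by rewrite mulf_neq0 ?invr_eq0.
rewrite /resolvent; have -> : (1 : R)%:C = 1 :> C by [].
have -> : (-1 : R)%:C = -1 :> C by rewrite rmorphN.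
have -> : (2 : R)%:C = 2 :> C by rewrite rmorph_nat.
have -> : (1 - z / zeta)^-1 = zeta / (zeta - z).
  have -> : 1 - z / zeta = (zeta - z) / zeta by field.
  by rewrite invf_div.
by field.
Qed.

Section Nu.
Variable nu : {finite_measure set plane -> \bar R}.
Local Notation cint := (cint nu).
Local Notation circle_mass := (circle_mass nu).

Definition inner z := cexp (- cint (fun zeta => (zeta + z) / (zeta - z))).

Lemma bmeasZ (c : C) (k : C -> C) : bmeas k -> bmeas (fun zeta => c * k zeta).
Proof. by move=> hk; apply: bmeasM => //; exact: bmeas_cst. Qed.

Lemma cint_cayley z : disk z -> cint (fun zeta => (zeta + z) / (zeta - z)) =
  cint (fun zeta => 2%:C * resolvent 1 z zeta + (-1)%:C).
Proof. by move=> zD; apply: eq_cint => zeta hz; exact: cayley. Qed.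

Lemma bmeas_cayley z : disk z -> bmeas (fun zeta => 2%:C * resolvent 1 z zeta + (-1)%:C).
Proof.
move=> zD; apply: bmeasD; last exact: bmeas_cst.
by apply: bmeasZ; exact: bmeas_resolvent.
Qed.

Lemma inner_polylim (r : R) : 0 <= r -> r < 1 -> polylim (cball 0 r) inner.
Proof.
move=> r0 r1; pose q (z : C) : C := - (2%:C) * cint (resolvent 1 z) - cint (fun=> (-1)%:C).
apply: (@polylim_ext _ _ (fun z => cexp (q z))) => [z|].
  rewrite /cball /= subr0 => zr; have zD : disk z by exact: le_lt_trans r1.
  rewrite /inner cint_cayley // /q cintD ?cintZ ?opprD ?mulNr //.
  - exact: bmeas_resolvent.
  - by apply: bmeasZ; exact: bmeas_resolvent.
  - exact: bmeas_cst.
apply: (polylim_exp (@cball_le _ _ _)); apply: polylimD; last exact: polylim_cst.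
apply: (polylimM (@cball_le _ _ _)); first exact: polylim_cst.
exact: polylim_resolvent.
Qed.

Lemma inner_analytic : analytic_on_disk inner.
Proof.
apply: polylim_analytic => b b1; have b1' : cabs b < 1 := b1.
exists ((1 - cabs b) / 2); first by rewrite divr_gt0 // subr_gt0.
have b0 := cabs_ge0 b.
have h : polylim (cball 0 ((1 + cabs b) / 2)) inner by apply: inner_polylim; lra.
by apply: polylim_sub h; apply: cball_sub; rewrite subr0; lra.
Qed.

Lemma inner_le1 z : disk z -> cabs (inner z) <= 1.
Proof.
move=> zD; rewrite /inner cabs_cexp -[leRHS]expR0 ler_expR cint_cayley //.
rewrite -[- cint _]mulN1r -cintZ; last exact: bmeas_cayley.
rewrite -(mul0r circle_mass); apply: Re_cint_le; first by apply: bmeasZ; exact: bmeas_cayley.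
move=> zeta hz; rewrite mulN1r ReN ReD /= oppr_le0 subr_ge0.
by apply: Re_inv_ge_half; rewrite cabs_circle_div.
Qed.

Variable Lambda : R -> R.
Hypothesis Lambda_gt0 : forall t : R, 0 < t <= 2 -> 0 < Lambda t.
Hypothesis Lambda_noninc :
  forall s t : R, 0 < s -> s <= t -> t <= 2 -> Lambda t <= Lambda s.
Hypothesis Lambda_int :
  (\int[@lebesgue_measure R]_(t in `]0%R, 2%R]) (Lambda t)%:E = +oo)%E.

(** The exponential of the integral of an average of shifted kernels. The number of
    scales is chosen so that the weights sum to more than [2 * circle_mass / e]; this
    keeps the real part of the exponent below [Lambda]. The modulus is controlled
    because every shift is at most [e]. *)
Lemma almost_inverse e : 0 < e -> e < 1 -> exists F : C -> C,
  polylim (cball 0 1) F /\ forall z, disk z -> exists u, [/\ F z * inner z = cexp u,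
    complex.Re u <= Lambda (1 - cabs z) &
    cabs u <= 12 * circle_mass * e / (1 - cabs z) ^+ 2].
Proof.
move=> e0 e1; have tot0 := circle_mass_ge0 nu.
have [n hn] := jump_sum_unbounded Lambda_gt0 Lambda_noninc Lambda_int (2 * circle_mass / e).
set W := \sum_(i < n) _ in hn.
have W0 : 0 < W by apply: le_lt_trans hn; rewrite divr_ge0 ?mulr_ge0 // ltW.
have jump0 := jump_ge0 Lambda_noninc.
pose c i := jump Lambda i * dyad R i.+1 / W.
have c0 i : 0 <= c i by rewrite divr_ge0 ?mulr_ge0 ?jump0 ?(ltW W0) // ltW ?dyad_gt0.
have c2 i : 0 <= 2 * c i by apply: mulr_ge0.
have csum : \sum_(i < n) c i = 1 by rewrite -mulr_suml divff // lt0r_neq0.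
pose d i := e * dyad R i.+1.
have d0 i : 0 < d i by rewrite mulr_gt0 ?dyad_gt0.
have de i : d i <= e by rewrite ler_piMr ?dyad_le1 // ltW.
pose K z zeta := \sum_(i < n) (2 * c i * (1 - e))%:C * resolvent (1 + d i) z zeta + (-1)%:C.
have bmeasK z : cabs z <= 1 -> bmeas (K z).
  move=> z1; apply: bmeasD; last exact: bmeas_cst.
  apply: (@bmeas_sum _ n (fun i zeta => (2 * c i * (1 - e))%:C * resolvent (1 + d i) z zeta)) => i.
  by apply: bmeasZ; apply: bmeas_resolvent; rewrite (le_lt_trans z1) // ltrDl.
exists (fun z => cexp (cint (K z))); split.
  apply: (polylim_exp (@cball_le _ _ _)).
  apply: (@polylim_ext _ _ (fun z => \sum_(i < n) (2 * c i * (1 - e))%:C *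
      cint (resolvent (1 + d i) z) + cint (fun=> (-1)%:C))) => [z|].
    rewrite /cball /= subr0 => z1.
    have nr i : bmeas (resolvent (1 + d i) z).
      by apply: bmeas_resolvent; rewrite (le_lt_trans z1) // ltrDl.
    rewrite /K cintD; last 2 first.
    - apply: (@bmeas_sum _ n (fun i zeta => (2 * c i * (1 - e))%:C * resolvent (1 + d i) z zeta)).
      by move=> i; exact: bmeasZ.
    - exact: bmeas_cst.
    congr (_ + _).
    rewrite (@cint_sum _ _ n (fun i zeta => (2 * c i * (1 - e))%:C * resolvent (1 + d i) z zeta)).
      by apply: eq_bigr => i _; rewrite cintZ.
    by move=> i; exact: bmeasZ.
  apply: polylimD; last exact: polylim_cst.
  elim: (n) => [|m IHm].
    by apply: (polylim_ext _ (@polylim_cst _ _ 0)) => z _; rewrite big_ord0.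
  pose r z := (2 * c m * (1 - e))%:C * cint (resolvent (1 + d m) z).
  have hr : polylim (cball 0 1) r.
    apply: (polylimM (@cball_le _ _ _)); first exact: polylim_cst.
    by apply: polylim_resolvent; rewrite ?ltrDl.
  by apply: polylim_ext (polylimD IHm hr) => z _; rewrite big_ord_recr.
move=> z zD; have z1 : cabs z < 1 := zD.
set t := 1 - cabs z.
have t0 : 0 < t by rewrite subr_gt0.
have t1 : t <= 1 by rewrite gerBl cabs_ge0.
have hzc := bmeas_cayley zD; have hK := bmeasK z (ltW z1).
pose D zeta := K z zeta + -1 * (2%:C * resolvent 1 z zeta + (-1)%:C).
have hD : bmeas D by apply: bmeasD => //; exact: bmeasZ.
exists (cint D).
pose x zeta : C := 1%:C - z / zeta.
have DE zeta : D zeta = \sum_(i < n) (2 * c i)%:C *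
    ((1 - e)%:C * ((d i)%:C + x zeta)^-1 - (x zeta)^-1).
  rewrite /D mulN1r opprD addrACA subrr addr0.
  have -> : 2%:C * resolvent 1 z zeta = \sum_(i < n) (2 * c i)%:C * (x zeta)^-1.
    by rewrite -mulr_suml -rmorph_sum /= -mulr_sumr csum mulr1.
  rewrite -sumrB; apply: eq_bigr => i _.
  rewrite [RHS]mulrBr [in RHS]mulrA -[in RHS]rmorphM /=; congr (_ * _^-1 - _).
  by rewrite /x addrA rmorphD /= [1%:C + _]addrC.
have xt zeta : circle zeta -> t <= complex.Re (x zeta).
  move=> hz; rewrite /x ReD ReN /= lerD2l lerN2 (le_trans (ler_norm _)) //.
  by rewrite (le_trans (Re_le_cabs _)) // cabs_circle_div.
have x2 zeta : circle zeta -> cabs (x zeta) <= 2.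
  move=> hz; rewrite (le_trans (cabs_le_sub _ _)) // cabs_circle_div // cabs_real normr1.
  by move: z1; lra.
have L0 : 0 < Lambda t by apply: Lambda_gt0; rewrite t0 (le_trans t1) ?ler1n.
split.
- rewrite /inner -cexpD; congr cexp.
  rewrite cint_cayley // /D [RHS]cintD //; last exact: bmeasZ.
  by rewrite [in RHS]cintZ // mulN1r.
- apply: (@le_trans _ _ (2 / (W * e) * Lambda t * circle_mass)).
    apply: Re_cint_le => // zeta hz; rewrite DE.
    rewrite (raddf_sum (@complex.Re R : Rcomplex R -> R)) /=.
    apply: (@le_trans _ _ (2 / (W * e) * \sum_(i < n) jump Lambda i * (t < dyad R i.+1)%R%:R)).
      rewrite mulr_sumr; apply: ler_sum => i _; rewrite ReZ.
      have := Re_inv_shift_le e0 (d0 i) t0 (xt _ hz).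
      rewrite {2}/d [e * _ / _]mulrAC divff ?lt0r_neq0 // mul1r => h.
      rewrite (le_trans (ler_wpM2l (c2 i) h)) //.
      rewrite le_eqVlt; apply/orP; left; apply/eqP; rewrite /c /d.
      have := lt0r_neq0 (dyad_gt0 R i.+1); have := lt0r_neq0 W0; have := lt0r_neq0 e0.
      move: ((t < dyad R i.+1)%R%:R : R) (dyad R i.+1) => v y e' W' y'; field.
      by rewrite e' W' y'.
    rewrite ler_wpM2l ?divr_ge0 ?mulr_ge0 ?(ltW W0) ?(ltW e0) //.
    exact: sum_jump_le.
  rewrite mulrAC ler_piMl ?(ltW L0) // mulrAC ler_pdivrMr ?mulr_gt0 // mul1r.
  by rewrite -ler_pdivrMr // ltW.
apply: le_trans (@cint_bound _ nu D (6 * e / t ^+ 2) hD _) _; last first.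
  by rewrite le_eqVlt; apply/orP; left; apply/eqP; field; rewrite lt0r_neq0.
move=> zeta hz; rewrite DE (le_trans (cabs_sum _ _ _)) //.
apply: (@le_trans _ _ (\sum_(i < n) c i * (6 * e / t ^+ 2))); last first.
  by rewrite -mulr_suml csum mul1r.
apply: ler_sum => i _; rewrite cabsM cabs_real (ger0_norm (c2 i)).
rewrite -[leLHS]mulrA mulrCA ler_wpM2l //.
have := cabs_inv_shift_le (ltW e0) (ltW e1) (ltW (d0 i)) t0 (xt _ hz) (x2 _ hz).
move=> h; rewrite (le_trans (ler_wpM2l (ler0n R 2) h)) //.
rewrite mulrA ler_wpM2r ?invr_ge0 ?exprn_ge0 ?(ltW t0) //.
by have := de i; lra.
Qed.

End Nu.
End Kernels.

(** * Cyclicity *)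

Section Cyclicity.
Variable R : realType.
Local Notation C := R[i].
Local Notation plane := (measurableTypeR R * measurableTypeR R)%type.
Variable Lambda : R -> R.
Hypothesis Lambda_gt0 : forall t : R, 0 < t <= 2 -> 0 < Lambda t.
Hypothesis Lambda_noninc :
  forall s t : R, 0 < s -> s <= t -> t <= 2 -> Lambda t <= Lambda s.
Hypothesis Lambda_int :
  (\int[@lebesgue_measure R]_(t in `]0%R, 2%R]) (Lambda t)%:E = +oo)%E.
Variable nu : {finite_measure set plane -> \bar R}.
Local Notation U := (inner nu).
Local Notation sqnorm := (sqnorm Lambda).

Lemma disk_cball (z : C) : disk z -> cball 0 1 z.
Proof. by rewrite /cball /= subr0 => /ltW. Qed.

Lemma polylim_cmeasurable (f : C -> C) : polylim (cball 0 1) f -> cmeasurable (@pdisk R) f.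
Proof.
move=> hf; have /choice[p hp] : forall n, exists p : {poly C}, forall z, cball 0 1 z ->
    cabs (p.[z] - f z) <= n.+1%:R^-1 by move=> n; apply: hf; rewrite invr_gt0 ltr0n.
apply: (cmeasurable_lim (fun n => cmeasurable_poly _ (p n))) => w wD e e0.
exists (Num.truncn e^-1) => n Nn; apply: le_trans (hp n _ (disk_cball wD)) _.
rewrite -[leRHS]invrK lef_pV2 ?posrE ?invr_gt0 ?ltr0n //.
by rewrite (le_trans (ltW (truncnS_gt _))) // ler_nat.
Qed.

Lemma cmeasurable_inner : cmeasurable (@pdisk R) U.
Proof. exact/analytic_cmeasurable/inner_analytic. Qed.

Lemma sqnorm_mul_le (f g : C -> C) (M : R) : cmeasurable (@pdisk R) f -> cmeasurable (@pdisk R) g ->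
  0 <= M -> (forall z, disk z -> cabs (f z) <= M) ->
  (sqnorm (fun z => f z * g z)%R <= (M ^+ 2)%:E * sqnorm g)%E.
Proof.
move=> mf mg M0 fM; have mg2 := measurable_cabs_sqr mg.
have M2 : 0 <= M ^+ 2 by exact: sqr_ge0.
rewrite /sqnorm -(massZ Lambda_gt0 Lambda_noninc M2 mg2) => [|w _]; last exact: sqr_ge0.
apply: le_mass => // [||w _|w wD].
- exact: measurable_cabs_sqr (cmeasurableM mf mg).
- by apply: measurable_funM => //; exact: measurable_cst.
- exact: sqr_ge0.
by rewrite cabsM exprMn ler_wpM2r ?sqr_ge0 // lerXn2r ?nnegrE ?cabs_ge0 // fM.
Qed.

(** Dominated convergence: the integrand is at most $(e^\Lambda + 1)^2 e^{-2\Lambda} \le 4$. *)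
Lemma approx_one (e : R) : 0 < e -> exists2 F : C -> C, polylim (cball 0 1) F &
  (sqnorm (fun z => F z * U z - 1)%R <= e%:E)%E.
Proof.
move=> e0; have nu0 := circle_mass_ge0 nu.
pose d n : R := n.+2%:R^-1.
have d0 n : 0 < d n by rewrite invr_gt0 ltr0n.
have d1 n : d n < 1 by rewrite invf_lt1 ?ltr1n // ltr0n.
have /choice[F hF] n := almost_inverse nu Lambda_gt0 Lambda_noninc Lambda_int (d0 n) (d1 n).
pose phi n (w : plane) : R := cabs (F n (toC w) * U (toC w) - 1) ^+ 2.
have mphi n : measurable_fun (@pdisk R) (phi n).
  apply: (measurable_cabs_sqr (f := fun z => F n z * U z - 1)).
  apply: cmeasurableB; last exact: cmeasurable_cst.
  by apply: cmeasurableM cmeasurable_inner; apply: polylim_cmeasurable; have [] := hF n.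
have mD : measurable (@pdisk R) by exact: measurable_pdisk.
have phi_le n w : (@pdisk R) w -> phi n w * weight Lambda w <= 4.
  move=> wD; have [_ /(_ _ wD)[u [FU uL _]]] := hF n.
  set L := Lambda _ in uL.
  have L0 : 0 < L by exact: pdisk_Lambda.
  have h1 : cabs (F n (toC w) * U (toC w) - 1) <= expR L *+ 2.
    rewrite (le_trans (cabs_le_sub _ _)) // cabs1 FU cabs_cexp mulr2n lerD //.
      by rewrite ler_expR.
    by rewrite -expR0 ler_expR ltW.
  rewrite /phi /weight -/L; apply: (@le_trans _ _ ((expR L *+ 2) ^+ 2 * expR (- (2 * L)))).
    by rewrite ler_wpM2r ?expR_ge0 // lerXn2r ?nnegrE ?cabs_ge0 // mulrn_wge0 ?expR_ge0.
  have E1 : expR (2 * L) = expR L ^+ 2 by rewrite -expRM_natl.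
  have E2 : expR (2 * L) * expR (- (2 * L)) = 1 by rewrite -expRD subrr expR0.
  rewrite (_ : _ * _ = 4 * (expR (2 * L) * expR (- (2 * L)))); last by rewrite E1; ring.
  by rewrite E2 mulr1.
have phi0 n w : 0 <= phi n w * weight Lambda w.
  by rewrite mulr_ge0 ?sqr_ge0 // ltW // weight_gt0.
have cv w : (@pdisk R) w -> (phi n w * weight Lambda w) @[n --> \oo] --> (0 : R).
  move=> wD; rewrite -[X in _ --> X](mul0r (weight Lambda w)); apply: cvgMr_tmp.
  rewrite [X in _ --> X](_ : 0 = 0 ^+ 2); last by rewrite expr0n.
  apply: (@cvg_comp _ _ _ _ (fun x : R => x ^+ 2)); last exact: (@exprn_continuous R 2).
  have w1 : cabs (toC w) < 1 := wD.
  pose K := 12 * circle_mass nu / (1 - cabs (toC w)) ^+ 2.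
  have K0 : 0 <= K by apply: divr_ge0; [exact: mulr_ge0|exact: sqr_ge0].
  have bound n : exists u : C, F n (toC w) * U (toC w) = cexp u /\ cabs u <= K * d n.
    have [_ /(_ _ wD)[u [FU _ uK]]] := hF n; exists u; split=> //.
    by rewrite /K mulrAC.
  have dlim : K * d n @[n --> \oo] --> 0.
    rewrite -[X in _ --> X](mulr0 K); apply: cvgMl_tmp.
    have := @cvg_harmonic R; rewrite -(cvg_shiftS (@harmonic R)); exact.
  apply/cvgrPdist_le => r r0.
  pose s := Num.min (1 / 2) (r / 6).
  have s0 : 0 < s by rewrite lt_min; apply/andP; split; lra.
  move/cvgrPdist_le : dlim => /(_ _ s0)[N _ hN]; exists N => // n /= /hN.
  rewrite sub0r normrN (ger0_norm (mulr_ge0 K0 (ltW (d0 n)))) => ds.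
  rewrite sub0r normrN ger0_norm ?cabs_ge0 //.
  have [u [-> uK]] := bound n; have us := le_trans uK ds.
  have s1 : s <= 1 / 2 by rewrite ge_min lexx.
  have s2 : s <= r / 6 by rewrite ge_min lexx orbT.
  have := cabs_cexpB_le (le_trans us s1); have := cabs_ge0 u => u0 h.
  have := cabs_le_add (cexp u - 1 - u) u; rewrite subrK => /le_trans; apply.
  by move: h; rewrite -mulr_natl; nra.
have lim0 : sqnorm (fun z => F n z * U z - 1)%R @[n --> \oo] --> 0%E.
  have := @dominated_cvg _ _ R (@area R) (@pdisk R) mD
    (fun n w => (phi n w * weight Lambda w)%:E) (cst 0%E) (cst 4%:E)
    (fun n => measurable_mass Lambda_gt0 Lambda_noninc (mphi n)) _ _ _ _.
  rewrite integral0; apply.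
  - by move=> w wD; apply: (@cvg_EFin _ _ _ _ (fun n => (phi n w * weight Lambda w)%:E));
      [exact: nearW|exact: cv].
  - by [].
  - apply/integrableP; split; first exact: measurable_cst.
    by rewrite /= integral_cst // lte_mul_pinfty // area_pdisk.
  - by move=> n w wD; rewrite /= lee_fin ger0_norm // phi_le.
have [n hn] : exists n, (sqnorm (fun z => F n z * U z - 1)%R <= e%:E)%E.
  have : \forall n \near \oo, (sqnorm (fun z => F n z * U z - 1)%R < e%:E)%E.
    apply: (lim0 [set x | x < e%:E]%E); apply: open_nbhs_nbhs.
    by split; [exact: open_ereal_lt_ereal|rewrite /= lte_fin].
  by move=> [N _ /(_ N (leqnn _)) /= h]; exists N; exact: ltW.
by exists (F n) => //; have [] := hF n.
Qed.

Lemma inner_B2 : B2 Lambda U.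
Proof.
split; first exact: inner_analytic.
rewrite B2norm_lty //; apply: le_lt_trans (sqnorm_bounded Lambda_gt0 Lambda_noninc
  cmeasurable_inner (@inner_le1 _ nu)) _.
by rewrite lte_mul_pinfty // area_pdisk.
Qed.

Lemma poly_bounded (p : {poly C}) : exists2 M : R, 0 < M &
  forall z, disk z -> cabs p.[z] <= M.
Proof.
have [M M0 hM] := polylim_bounded (@cball_le _ _ _) (polylim_poly (cball 0 1) p).
by exists M => // z /disk_cball/hM.
Qed.

(** With $p$ near $g$, $F$ from [approx_one] and $q$ near $F$, the difference is split
    as $pqU - g = p(q-F)U + p(FU-1) + (p-g)$. *)
Lemma inner_cyclic : B2cyclic Lambda U.
Proof.
split; first exact: inner_B2.
move=> g gB2 e e0.
have mU := cmeasurable_inner.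
have mg := analytic_cmeasurable gB2.1.
pose r := e ^+ 2 / 16.
have r0 : 0 < r by rewrite divr_gt0 ?exprn_gt0.
have [p hp] := poly_dense Lambda_gt0 Lambda_noninc gB2 r0.
have [M M0 hM] := poly_bounded p.
have M2 : 0 < M ^+ 2 by rewrite exprn_gt0.
have [F hF F1] := approx_one (divr_gt0 r0 M2).
pose A := fine (@area R (@pdisk R)).
have AE : (@area R (@pdisk R)) = A%:E.
  by rewrite fineK // ge0_fin_numE ?measure_ge0 // area_pdisk.
have A0 : 0 <= A by rewrite fine_ge0 // measure_ge0.
pose s := Num.min 1 (r / (M ^+ 2 * (A + 1))).
have D0 : 0 < M ^+ 2 * (A + 1) by rewrite mulr_gt0 // ltr_wpDl.
have s0 : 0 < s by rewrite lt_min ltr01 divr_gt0.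
have s2 : s ^+ 2 * (M ^+ 2 * A) <= r.
  apply: (@le_trans _ _ (s * (M ^+ 2 * (A + 1)))); last first.
    by rewrite -ler_pdivlMr // ge_min lexx orbT.
  apply: ler_pM; [exact: sqr_ge0|exact: mulr_ge0 (ltW M2) A0| |].
    by rewrite expr2 ler_piMl ?(ltW s0) // ge_min lexx.
  by rewrite ler_wpM2l ?(ltW M2) // lerDl.
have [q hq] := hF s s0.
exists (fun z => (p * q).[z] * U z); first by exists (p * q).
apply: B2norm_lt => //.
have mF := polylim_cmeasurable hF.
have mp := cmeasurable_poly (@pdisk R) p.
have mq := cmeasurable_poly (@pdisk R) q.
have mqF := cmeasurableB mq mF.
have mFU := cmeasurableB (cmeasurableM mF mU) (cmeasurable_cst (@pdisk R) 1).
pose a (z : C) := p.[z] * ((q.[z] - F z) * U z).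
pose b (z : C) := p.[z] * (F z * U z - 1).
pose c (z : C) := p.[z] - g z.
have ma : cmeasurable (@pdisk R) a := cmeasurableM mp (cmeasurableM mqF mU).
have mb : cmeasurable (@pdisk R) b := cmeasurableM mp mFU.
have mc : cmeasurable (@pdisk R) c := cmeasurableB mp mg.
have -> : sqnorm ((fun z => (p * q).[z] * U z) \- g)%R = sqnorm (fun z => a z + (b z + c z))%R.
  by apply: eq_sqnorm => z _; rewrite /= /a /b /c hornerM; ring.
have ha : (sqnorm a <= r%:E)%E.
  apply: le_trans (sqnorm_mul_le mp (cmeasurableM mqF mU) (ltW M0) hM) _.
  have h : (sqnorm (fun z => (q.[z] - F z) * U z)%R <= (s ^+ 2)%:E * @area R (@pdisk R))%E.
    apply: (sqnorm_bounded Lambda_gt0 Lambda_noninc (cmeasurableM mqF mU)) => z zD.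
    rewrite cabsM -[s]mulr1 ler_pM ?cabs_ge0 ?inner_le1 //.
    exact/hq/disk_cball.
  apply: le_trans (lee_wpmul2l _ h) _; first by rewrite lee_fin ltW.
  by rewrite AE -!EFinM lee_fin mulrCA.
have hb : (sqnorm b <= r%:E)%E.
  apply: le_trans (sqnorm_mul_le mp mFU (ltW M0) hM) _.
  apply: le_trans (lee_wpmul2l _ F1) _; first by rewrite lee_fin ltW.
  by rewrite -EFinM mulrC divfK // lt0r_neq0.
apply: le_lt_trans (sqnorm_add Lambda_gt0 Lambda_noninc ma (cmeasurableD mb mc)) _.
have hbc : (sqnorm (fun z => b z + c z)%R <= (4 * r)%:E)%E.
  apply: le_trans (sqnorm_add Lambda_gt0 Lambda_noninc mb mc) _.
  apply: (@le_trans _ _ (2%:E * r%:E + 2%:E * r%:E)%E).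
    by apply: leeD; apply: lee_wpmul2l; rewrite ?lee_fin.
  by rewrite -!EFinM -EFinD lee_fin; lra.
apply: (@le_lt_trans _ _ (2%:E * r%:E + 2%:E * (4 * r)%:E)%E).
  by apply: leeD; apply: lee_wpmul2l; rewrite ?lee_fin.
rewrite -!EFinM -EFinD lte_fin /r; have := exprn_gt0 2 e0; lra.
Qed.

End Cyclicity.

Lemma eq_B2norm (R : realType) (Lambda : R -> R) (f g : R[i] -> R[i]) :
  (forall z, disk z -> f z = g z) -> B2norm Lambda f = B2norm Lambda g.
Proof. by move=> h; rewrite !B2normE; congr sqrte; exact: eq_sqnorm. Qed.

(** Only the values inside the disk matter: analyticity is tested on balls shrunk to
    stay in the disk. *)
Lemma eq_B2 (R : realType) (Lambda : R -> R) (f g : R[i] -> R[i]) :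
  (forall z, disk z -> f z = g z) -> B2 Lambda f -> B2 Lambda g.
Proof.
move=> h [fa fb]; split; last by rewrite -(eq_B2norm Lambda h).
apply: polylim_analytic => b bD; have b1 : cabs b < 1 := bD.
have [r r0 [c /useries_polylim hc]] := analytic_useries fa bD.
pose s := Num.min r ((1 - cabs b) / 2).
have s0 : 0 < s by rewrite lt_min r0 divr_gt0 // subr_gt0.
have s1 : s <= (1 - cabs b) / 2 by rewrite ge_min lexx orbT.
have s2 : s <= r by rewrite ge_min lexx.
exists s => //; apply: (@polylim_ext _ _ f) => [z zb|].
  apply: h; rewrite /disk /=; have := cabs_le_add (z - b) b; rewrite subrK.
  by move: zb; rewrite /cball /=; lra.
by apply: polylim_sub hc; apply: cball_sub; rewrite subrr cabs0 add0r.
Qed.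

Theorem mainTheorem3 (R : realType) (Lambda : R -> R)
  (Lambda_gt0 : forall t : R, 0 < t <= 2 -> 0 < Lambda t)
  (Lambda_noninc : forall s t : R, 0 < s -> s <= t -> t <= 2 -> Lambda t <= Lambda s)
  (Lambda_0 : Lambda t @[t --> 0^'+] --> +oo)
  (Lambda_int :
    (\int[@lebesgue_measure R]_(t in `]0%R, 2%R]) (Lambda t)%:E = +oo)%E)
  (U : R[i] -> R[i]) (hU : singular_inner U) :
  B2cyclic Lambda U.
Proof.
case: hU => nu [_ _ UE].
have EU z : disk z -> inner nu z = U z by move=> zD; rewrite UE.
have [IB2 Idense] := inner_cyclic Lambda_gt0 Lambda_noninc Lambda_int nu.
split; first exact: eq_B2 EU IB2.
move=> g gB2 e e0; have [_ [p _ <-] hp] := Idense g gB2 e e0.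
exists (fun z => p.[z] * U z); first by exists p.
rewrite (@eq_B2norm _ _ _ ((fun z => p.[z] * inner nu z) \- g)%R) // => z zD /=.
by rewrite EU.
Qed.
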